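(* Let $\alpha,\beta\in\mathbb{R}$ with $\alpha\neq0$, and assume that the operator $\Lambda=\alpha-\beta\partial_x^2$ is invertible on $C^\infty(S^1)$. The Euler equation $$\alpha(v_t+3vv_x)-\beta(v_{xxt}+2v_xv_{xx}+vv_{xxx})-bv_{xxx}=0,\qquad b_t=0,$$ for the right-invariant $H^1_{\alpha,\beta}$-metric on the Virasoro group is bihamiltonian on the dual $vir^*$ of the Virasoro algebra (via the identification $(u(dx)^2,a)=((\Lambda v)(dx)^2,b)$): it is Hamiltonian with respect to the Lie–Poisson structure on $vir^*$ and with respect to the constant Poisson structure on $vir^*$ whose ''freezing'' point is $\left(\frac{\alpha}{2}(dx)^2,\beta\right)$.
   Context: Functions are smooth, $S^1=\mathbb{R}/2\pi\mathbb{Z}$ with coordinate $x$. The Virasoro algebra is $vir=vect(S^1)\oplus\mathbb{R}$ with commutator $$[(v\partial_x,b),(w\partial_x,c)]=\Big((-vw_x+v_xw)\partial_x,\ \int_{S^1}vw_{xxx}\,dx\Big).$$ Its smooth dual is $vir^*=\{(u(x)(dx)^2,a): u\in C^\infty(S^1),\,a\in\mathbb{R}\}$, with pairing $\langle(u(dx)^2,a),(w\partial_x,c)\rangle=\int_{S^1}uw\,dx+ac$. The $H^1_{\alpha,\beta}$-energy on $vir$ is $\langle(v\partial_x,b),(w\partial_x,c)\rangle_{H^1_{\alpha,\beta}}=\int_{S^1}(\alpha vw+\beta v_xw_x)\,dx+bc$, extended to a right-invariant metric on the Virasoro group (the group with Lie algebra $vir$). Its inertia operator $A:vir\to vir^*$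 is $A(v\partial_x,b)=((\Lambda v)(dx)^2,b)$. The Euler equation on $vir^*$ is $\frac{dm}{dt}=-\mathrm{ad}^*_{A^{-1}m}m$, where $\langle\mathrm{ad}^*_Xm,Y\rangle=\langle m,[X,Y]\rangle$; in terms of $(v\partial_x,b)=A^{-1}m$ it is the equation displayed in the claim. For a Lie algebra $\mathfrak g$, the Lie–Poisson bracket on $\mathfrak g^*$ is $\{f,g\}_{LP}(m)=\langle[df,dg],m\rangle$, and the constant Poisson bracket with freezing point $m_0\in\mathfrak g^*$ is $\{f,g\}_0(m)=\langle[df,dg],m_0\rangle$, with the differentials taken at $m$ and regarded as elements of $\mathfrak g$ (for functionals on $vir^*$ these are variational derivatives $(\frac{\delta F}{\delta u}\partial_x,\frac{\delta F}{\delta a})$). The Hamiltonian equations with Hamiltonian function $f$ are respectively $\frac{dm}{dt}=\mathrm{ad}^*_{df}m$ and $\frac{dm}{dt}=\mathrm{ad}^*_{df}m_0$. A dynamical system is bihamiltonian with respect to two compatible Poisson structures (all linear combinations $\{\cdot,\cdot\}_0+\lambda\{\cdot,\cdot\}_1$ are Poisson) if its vector field is Hamiltonian with respect to both; the brackets $\{\cdot,\cdot\}_{LP}$ and $\{\cdot,\cdot\}_0$ are compatible for every $m_0$. *)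

(* Defs.v *)
From HB Require Import structures.
From mathcomp Require Import all_boot all_order all_algebra.
From mathcomp Require Import all_classical all_reals all_analysis.
Set Implicit Arguments.
Unset Strict Implicit.
Unset Printing Implicit Defensive.
Import Order.TTheory GRing.Theory Num.Theory.
Import numFieldTopology.Exports numFieldNormedType.Exports.
Local Open Scope classical_set_scope.
Local Open Scope ring_scope.

Section Smooth.
Variables (R : realType) (V : normedModType R).

(* All directional derivatives up to order [k] exist and are continuous on [D].
   For open [D] and finite-dimensional [V], the only case used below, this is
   the usual notion of a C^k function. *)
Fixpoint Ck_on (D : set V) (k : nat) (f : V -> R) : Prop :=
  (forall x, D x -> {for x, continuous f}) /\
  match k with
  | 0 => True
  | k'.+1 => forall h : V,
      (forall x, D x -> derivable f x h) /\ Ck_on D k' (fun x => 'D_h f x)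
  end.

Definition smooth_on (D : set V) (f : V -> R) : Prop := forall k, Ck_on D k f.

Definition smooth (f : V -> R) : Prop := smooth_on setT f.

Lemma Ck_onS (D : set V) k (f : V -> R) : Ck_on D k.+1 f -> Ck_on D k f.
Proof.
elim: k f => [|k IH] f [cf Hf]; split => // h.
by have [df Df] := Hf h; split => //; exact: IH.
Qed.

Lemma Ck_cst k (a : R) : Ck_on (setT : set V) k (fun=> a).
Proof.
elim: k a => [|k IH] a; split=> //; first by move=> x _; exact: cvg_cst.
  by move=> x _; exact: cvg_cst.
move=> h; split=> [x _|]; first exact: derivable_cst.
have -> : (fun x : V => 'D_h (fun=> a) x) = (fun=> 0).
  by apply/funext => x; rewrite derive_cst.
exact: IH.
Qed.

Lemma Ck_add k (f g : V -> R) :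
  Ck_on setT k f -> Ck_on setT k g -> Ck_on setT k (f + g).
Proof.
elim: k f g => [|k IH] f g [cf Hf] [cg Hg]; split=> //.
- by move=> x _; apply: continuousD; [exact: cf|exact: cg].
- by move=> x _; apply: continuousD; [exact: cf|exact: cg].
move=> h; have [df Df] := Hf h; have [dg Dg] := Hg h.
split=> [x _|]; first by apply: derivableD; [exact: df|exact: dg].
have -> : (fun x : V => 'D_h (f + g) x) =
          (fun x => 'D_h f x) + (fun x => 'D_h g x).
  by apply/funext => x; rewrite deriveD//; [exact: df|exact: dg].
exact: IH.
Qed.

Lemma Ck_mul k (f g : V -> R) :
  Ck_on setT k f -> Ck_on setT k g -> Ck_on setT k (f * g).
Proof.
elim: k f g => [|k IH] f g sf sg.
  by split=> // x _; apply: continuousM; [exact: sf.1|exact: sg.1].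
split=> [x _|h]; first by apply: continuousM; [exact: sf.1|exact: sg.1].
have [df Df] := sf.2 h; have [dg Dg] := sg.2 h.
split=> [x _|]; first by apply: derivableM; [exact: df|exact: dg].
have -> : (fun x : V => 'D_h (f * g) x) =
          f * (fun x => 'D_h g x) + g * (fun x => 'D_h f x).
  by apply/funext => x; rewrite deriveM//; [exact: df|exact: dg].
by apply: Ck_add; apply: IH => //; exact: Ck_onS.
Qed.

Lemma smooth_cst (a : R) : smooth (fun=> a).
Proof. by move=> k; exact: Ck_cst. Qed.

Lemma smooth_add (f g : V -> R) : smooth f -> smooth g -> smooth (f + g).
Proof. by move=> sf sg k; exact: Ck_add. Qed.

Lemma smooth_mul (f g : V -> R) : smooth f -> smooth g -> smooth (f * g).
Proof. by move=> sf sg k; exact: Ck_mul. Qed.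

Lemma smooth_derive (f : V -> R) h : smooth f -> smooth (fun x => 'D_h f x).
Proof. by move=> sf k; have [_ /(_ h) []] := sf k.+1. Qed.

End Smooth.

Section Circle.
Variable R : realType.

(* Functions on R / 2 pi Z are represented by their 2 pi-periodic lifts. *)
Definition circ_pred : {pred (R -> R)} :=
  fun f => `[< smooth f /\ forall x, f (x + 2 * pi) = f x >].

Record circ := Circ { circ_fun :> R -> R ; _ : circ_fun \in circ_pred }.

HB.instance Definition _ := [isSub for circ_fun].
HB.instance Definition _ := [Choice of circ by <:].

Lemma circ_predP f :
  reflect (smooth f /\ forall x, f (x + 2 * pi) = f x) (f \in circ_pred).
Proof. exact: asboolP. Qed.

Lemma circ_cst (a : R) : (fun=> a) \in circ_pred.
Proof. by apply/circ_predP; split=> //; exact: smooth_cst. Qed.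

Lemma circ_add f g : f \in circ_pred -> g \in circ_pred -> f + g \in circ_pred.
Proof.
move=> /circ_predP[sf pf] /circ_predP[sg pg].
apply/circ_predP; split; first exact: smooth_add.
by move=> x; rewrite /GRing.add /= pf pg.
Qed.

Lemma circ_mul f g : f \in circ_pred -> g \in circ_pred -> f * g \in circ_pred.
Proof.
move=> /circ_predP[sf pf] /circ_predP[sg pg].
apply/circ_predP; split; first exact: smooth_mul.
by move=> x; rewrite /GRing.mul /= pf pg.
Qed.

Lemma circ_subring : subring_closed circ_pred.
Proof.
split=> [|f g Pf Pg|]; [exact: circ_cst| |exact: circ_mul].
have -> : - g = (fun=> -1) * g.
  by apply/funext => x; rewrite /GRing.opp /GRing.mul /= mulN1r.
by apply: circ_add => //; apply: circ_mul => //; exact: circ_cst.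
Qed.

Lemma circ_scaler : GRing.scaler_closed circ_pred.
Proof.
move=> a f Pf.
have -> : a *: f = (fun=> a) * f by apply/funext.
by apply: circ_mul => //; exact: circ_cst.
Qed.

HB.instance Definition _ := GRing.isSubringClosed.Build (R -> R) circ_pred
  circ_subring.
HB.instance Definition _ := GRing.isScaleClosed.Build R (R -> R) circ_pred
  circ_scaler.
HB.instance Definition _ := [SubChoice_isSubComNzRing of circ by <:].
HB.instance Definition _ := [SubZmodule_isSubLmodule of circ by <:].

Lemma circ_derive1 f : f \in circ_pred -> derive1 f \in circ_pred.
Proof.
move=> /circ_predP[sf pf]; apply/circ_predP; split.
  have -> : derive1 f = (fun x => 'D_1 f x) by apply/funext => x; rewrite derive1E.
  exact: smooth_derive.
move=> x; rewrite /derive1 pf.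
suff -> : (fun h => h^-1 *: (f (h + (x + 2 * pi)) - f x)) =
          (fun h => h^-1 *: (f (h + x) - f x)) by [].
by apply/funext => h; rewrite addrA pf.
Qed.

Definition Dx (f : circ) : circ := Circ (circ_derive1 (valP f)).

Definition cint (f : circ) : R :=
  \int[lebesgue_measure]_(x in `[0, 2 * pi]) f x.

End Circle.

Section Virasoro.
Variable R : realType.

(* [(v, b) : vir R] is (v d/dx, b), and [(u, a) : vir_dual R] is (u (dx)^2, a). *)
Definition vir : lmodType R := (circ R * R)%type.
Definition vir_dual : lmodType R := (circ R * R)%type.

Definition vbracket (X Y : vir) : vir :=
  (- (X.1 * Dx Y.1) + Dx X.1 * Y.1, cint (X.1 * Dx (Dx (Dx Y.1)))).

Definition pairing (m : vir_dual) (Y : vir) : R := cint (m.1 * Y.1) + m.2 * Y.2.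

(* [mu] is ad^*_X m. *)
Definition is_coad (X : vir) (m mu : vir_dual) : Prop :=
  forall Y : vir, pairing mu Y = pairing m (vbracket X Y).

Section Euler.
Variables alpha beta : R.

Definition H1_metric (X Y : vir) : R :=
  cint (alpha *: (X.1 * Y.1) + beta *: (Dx X.1 * Dx Y.1)) + X.2 * Y.2.

Definition Lambda (v : circ R) : circ R := alpha *: v - beta *: Dx (Dx v).

Definition inertia (X : vir) : vir_dual := (Lambda X.1, X.2).

(* E m = - ad^*_{A^-1 m} m, written at the point m = A X. *)
Definition is_euler_field (E : vir_dual -> vir_dual) : Prop :=
  forall X : vir, is_coad X (inertia X) (- E (inertia X)).

Definition euler_equation_at (v : R -> circ R) (b : R -> R) (t x : R) : Prop :=
  let v_ := v t x in
  let vx := Dx (v t) x in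
  let vxx := Dx (Dx (v t)) x in
  let vxxx := Dx (Dx (Dx (v t))) x in
  let vt := derive1 (fun s => v s x) t in
  let vxxt := derive1 (fun s => Dx (Dx (v s)) x) t in
  alpha * (vt + 3 * v_ * vx) - beta * (vxxt + 2 * vx * vxx + v_ * vxxx)
    - b t * vxxx = 0.

End Euler.

(* Joint smoothness in the parameter and in x, i.e. smoothness as a map from
   [D] into the Frechet space C^oo(S^1) x R. *)
Definition smooth_family (V : normedModType R) (D : set V)
    (p : V -> circ R * R) : Prop :=
  smooth_on (D `*` [set: R]) (fun z : V * R => (p z.1).1 z.2) /\
  smooth_on D (fun s => (p s).2).

(* d/dt m(t) = mu, the derivative of a curve in [vir_dual]. *)
Definition is_velocity (m : R -> vir_dual) (t : R) (mu : vir_dual) : Prop :=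
  (forall x, is_derive t 1 (fun s => (m s).1 x) (mu.1 x)) /\
  is_derive t 1 (fun s => (m s).2) mu.2.

(* Smooth functions on the Frechet space [vir_dual] whose differential lies in
   [vir] (rather than in the bidual) and depends smoothly on the point; [grad]
   is the pair of variational derivatives.  A map on a Frechet space is smooth
   when it sends smooth finite-dimensional families to smooth families. *)
Record functional := Functional {
  fval :> vir_dual -> R ;
  grad : vir_dual -> vir ;
  gradP : forall m h : vir_dual,
    is_derive (0 : R) 1 (fun e : R => fval (m + e *: h)) (pairing h (grad m)) ;
  fval_smooth : forall n (p : 'rV[R]_n -> vir_dual),
    smooth_family setT p -> smooth (fun s => fval (p s)) ;
  grad_smooth : forall n (p : 'rV[R]_n -> vir_dual),
    smooth_family setT p -> smooth_family setT (fun s => grad (p s)) }.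

Definition bracket_op := functional -> functional -> vir_dual -> R.

Definition LP_bracket : bracket_op :=
  fun f g m => pairing m (vbracket (grad f m) (grad g m)).

Definition frozen_bracket (m0 : vir_dual) : bracket_op :=
  fun f g m => pairing m0 (vbracket (grad f m) (grad g m)).

(* Since [br f g] is a bare function, an iterated bracket is expressed through a
   functional having it as its underlying function. *)
Definition is_poisson (br : bracket_op) : Prop :=
  [/\ forall f g, exists k : functional, fval k = br f g,
      forall f g m, br f g m = - br g f m,
      forall (c : R) (f f' k g : functional),
        fval k = (fun m => c * f m + f' m) ->
        forall m, br k g m = c * br f g m + br f' g m,
      forall f f' k g : functional, fval k = (fun m => f m * f' m) ->
        forall m, br k g m = f m * br f' g m + br f g m * f' m
    & forall f g h fg gh hf : functional,
        fval fg = br f g -> fval gh = br g h -> fval hf = br h f ->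
        forall m, br fg h m + br gh f m + br hf g m = 0].

Definition compatible (br0 br1 : bracket_op) : Prop :=
  [/\ is_poisson br0, is_poisson br1
    & forall lambda : R,
        is_poisson (fun f g m => br0 f g m + lambda * br1 f g m)].

Definition LP_hamiltonian (E : vir_dual -> vir_dual) : Prop :=
  exists f : functional, forall m, is_coad (grad f m) m (E m).

Definition frozen_hamiltonian (m0 : vir_dual) (E : vir_dual -> vir_dual) :
  Prop := exists f : functional, forall m, is_coad (grad f m) m0 (E m).

Definition bihamiltonian (m0 : vir_dual) (E : vir_dual -> vir_dual) : Prop :=
  [/\ compatible (frozen_bracket m0) LP_bracket,
      LP_hamiltonian E & frozen_hamiltonian m0 E].

End Virasoro.

(* Main.v *)
Require Import Defs.
From mathcomp Require Import all_boot all_order all_algebra.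
From mathcomp Require Import all_classical all_reals all_analysis.
From mathcomp Require Import ring.
Set Implicit Arguments.
Unset Strict Implicit.
Unset Printing Implicit Defensive.
Import Order.TTheory GRing.Theory Num.Theory.
Import numFieldTopology.Exports numFieldNormedType.Exports.
Local Open Scope classical_set_scope.
Local Open Scope ring_scope.

(** The Euler field is E(m) = - ad^*_{A^-1 m} m, where by integration by parts
    ad^*_{(v, b)} (u, a) = (u_x v + 2 u v_x - a v_xxx, 0).  With u = Lambda v
    this is the displayed equation, term by term.

    It is Hamiltonian for the Lie-Poisson structure by construction, the
    Hamiltonian being minus the energy, - <m, A^-1 m> / 2, whose gradient is
    - A^-1 m because the inertia operator is symmetric ([energy_gradP]).
    For the frozen structure one observes that E(m) is a total derivative, and
    that ad^*_{(w, c)} (alpha/2, beta) = ((Lambda w)_x, 0).  So one needs a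
    functional F with Lambda (delta F / delta u) equal to the primitive of E(m).
    As u = Lambda v and Lambda is symmetric, Lambda (delta F / delta u) is
    delta F / delta v, and the cubic functional
    F = - int (alpha/2 v^3 + beta/2 v v_x^2 + a/2 v_x^2) works
    ([cubic_variation], [euler_field_frozen]).

    Two analytic points remain.  First, these Hamiltonians must be smooth, that
    is, Lambda^-1 must preserve smooth families of functions.  For beta = 0 it is
    a homothety; otherwise it is the convolution with an explicit periodic Green
    function of hyperbolic or trigonometric type ([green_solves]).  The
    trigonometric one fails to exist only in the resonant case, in which
    cos (w x) is a periodic element of the kernel of Lambda
    ([green_kernel_ex]).  Smoothness then reduces to differentiation under the
    integral sign ([pint_smooth]).

    Second, all brackets of the pencil must be Poisson ([pencil_poisson]).  They
    all are of the form {f, g}(m) = <n + lam m, [df, dg]>.  The bracket of two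
    functionals is again a functional: its gradient involves the derivatives of
    the gradients of f and g, which are symmetric bilinear forms as mixed second
    derivatives ([hess_sym], from [smooth_schwarz]).  The same symmetry makes the
    second derivatives cancel in the Jacobi identity, which thereby reduces to
    that of the Virasoro algebra ([vbracket_jacobi]).  The bracket is affine in
    (n, lam), so the pencil spanned by the frozen and the Lie-Poisson brackets
    is covered by this single computation. *)

(** * Smooth functions on normed spaces *)

Section Lines.
Variable R : realType.

(** Directional derivatives only see the function on a line, so two functions
    that agree along parametrized lines have the same difference quotients.
    This needs no differentiability, and is how every derivative of a
    composite with an affine map is computed below. *)
Lemma growth_eq (V W : normedModType R) (g : V -> R) (f : W -> R) x v y w :
  (forall e : R, g (e *: v + x) = f (e *: w + y)) ->
  (fun h : R => h^-1 *: ((g \o shift x) (h *: v) - g x)) =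
  (fun h : R => h^-1 *: ((f \o shift y) (h *: w) - f y)).
Proof.
move=> gf; apply/funext => h /=; rewrite gf; congr (_ *: (_ - _)).
by have := gf 0; rewrite !scale0r !add0r.
Qed.

Lemma derive_line (V W : normedModType R) (g : V -> R) (f : W -> R) x v y w :
  (forall e : R, g (e *: v + x) = f (e *: w + y)) -> 'D_v g x = 'D_w f y.
Proof. by move=> gf; rewrite /derive (growth_eq gf). Qed.

Lemma derivable_line (V W : normedModType R) (g : V -> R) (f : W -> R) x v y w :
  (forall e : R, g (e *: v + x) = f (e *: w + y)) ->
  derivable f y w -> derivable g x v.
Proof. by move=> gf; rewrite /derivable (growth_eq gf). Qed.

(** Linearity is stated on [e *: v + x], the shape of the points of a line. *)
Definition clinear (V W : normedModType R) (L : V -> W) :=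
  continuous L /\ forall (e : R) v x, L (e *: v + x) = e *: L v + L x.

Lemma Ck_lin (V W : normedModType R) (L : V -> W) (f : W -> R) k :
  clinear L -> Ck_on setT k f -> Ck_on setT k (f \o L).
Proof.
move=> [cL lL]; elim: k f => [|k IH] f [cf Hf]; split=> //.
- by move=> x _; apply: continuous_comp; [exact: cL|exact: cf].
- by move=> x _; apply: continuous_comp; [exact: cL|exact: cf].
move=> h; have [df Df] := Hf (L h).
have line x (e : R) : (f \o L) (e *: h + x) = f (e *: L h + L x) by rewrite /= lL.
split=> [x _|]; first exact: (derivable_line (line x) (df _ I)).
rewrite (_ : (fun x => _) = (fun x => 'D_(L h) f x) \o L); first exact: IH.
by apply/funext => x; rewrite (derive_line (line x)).
Qed.

Lemma smooth_lin (V W : normedModType R) (L : V -> W) (f : W -> R) :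
  clinear L -> smooth f -> smooth (f \o L).
Proof. by move=> lL sf k; apply: Ck_lin. Qed.

Lemma is_derive_affine (t c d : R) : is_derive t 1 (fun e : R => e * c + d) c.
Proof.
have -> : (fun e : R => e * c + d) = c *: (id : R -> R) + cst d.
  by apply/funext => e; rewrite mulrC.
by apply: is_derive_eq; rewrite addr0 [_ *: 1]mulr1.
Qed.

Lemma cancel_quotient (c a b u v : R) :
  c != 0 -> a = c * u -> b = c * v -> a = b -> u = v.
Proof. by move=> c0 -> -> /(mulfI c0). Qed.

Lemma dist_halves (a b c d : R) :
  `|a - b| < d / 2 -> `|c - b| < d / 2 -> `|a - c| <= d.
Proof.
move=> ab cb; rewrite (le_trans (ler_distD b _ _))// (splitr d) lerD// ltW//.
by rewrite distrC.
Qed.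

Section SmoothFunctions.
Variable V : normedModType R.
Implicit Types f : V -> R.

Lemma smooth_cont f : smooth f -> continuous f.
Proof. by move=> sf x; apply: (sf 0).1. Qed.

Lemma smooth_derivable f x h : smooth f -> derivable f x h.
Proof. by move=> sf; apply: ((sf 1%N).2 h).1. Qed.

Lemma smooth_linear f : clinear f -> smooth f.
Proof.
move=> [cf lf] k; elim: k => [|k IH]; (split; first by move=> x _; exact: cf) => // h.
have f0 : f 0 = 0 by have := lf (-1) 0 0; rewrite scaler0 add0r scaleN1r addNr.
have D x : is_derive x h f (f h).
  have line (e : R) : f (e *: h + x) = (fun e : R => e * f h + f x) (e *: 1 + 0).
    by rewrite lf addr0 [_ *: 1]mulr1.
  have [d1 d2] := is_derive_affine 0 (f h) (f x).
  split; first exact: (derivable_line line d1).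
  by rewrite -d2; exact: (derive_line line).
split=> [x _|]; first by have [] := D x.
rewrite (_ : (fun x => _) = fun=> f h); first exact: Ck_cst.
by apply/funext => x; have [] := D x.
Qed.

(** The line [e |-> f (e *: h + x)] is differentiable at every time, not only
    at the base point where a directional derivative is taken. *)
Lemma smooth_line f x h (t : R) : smooth f ->
  is_derive (t : R) 1 (fun e : R => f (e *: h + x)) ('D_h f (t *: h + x)).
Proof.
move=> sf.
pose g (e : R) := f (e *: h + x).
have line (e : R) : g (e *: 1 + t) = f (e *: h + (t *: h + x)).
  by rewrite /g [e *: 1]mulr1 scalerDl addrA.
split; first exact: (derivable_line line (smooth_derivable sf)).
exact: (derive_line line).
Qed.

Lemma smooth_MVT f x h (e : R) : smooth f -> e != 0 -> exists2 c : R,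
  `|c| <= `|e| & f (e *: h + x) - f x = e * 'D_h f (c *: h + x).
Proof.
move=> sf e0.
have dg (t : R) : is_derive t 1 (fun e : R => f (e *: h + x)) ('D_h f (t *: h + x)).
  exact: smooth_line.
have cg a b : {within `[a, b], continuous (fun e : R => f (e *: h + x))}.
  apply: derivable_within_continuous => t _; exact: ex_derive.
case: (ltrgtP e 0) e0 => // e0 _.
- have [c cab E] := MVT e0 (fun t _ => dg t) (cg _ _).
  exists c; last first.
    by move: E; rewrite scale0r !add0r => E; rewrite -opprB E mulrN opprK mulrC.
  move: cab; rewrite in_itv /= => /andP[ec c0].
  by rewrite !ltr0_norm// lerN2 ltW.
- have [c cab E] := MVT e0 (fun t _ => dg t) (cg _ _).
  exists c; last first.
    by move: E; rewrite scale0r !add0r => ->; rewrite ?oppr0 ?addr0 mulrC.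
  move: cab; rewrite in_itv /= => /andP[ec c0].
  by rewrite !gtr0_norm// ltW.
Qed.

Lemma smooth_shift f a : smooth f -> smooth (fun x => f (x + a)).
Proof.
move=> sf k; elim: k f sf => [|k IH] f sf.
  split=> // x _; apply: continuous_comp; last exact: smooth_cont.
  by apply: continuousD; [exact: cvg_id|exact: cvg_cst].
split=> [x _|h].
  apply: continuous_comp; last exact: smooth_cont.
  by apply: continuousD; [exact: cvg_id|exact: cvg_cst].
have line x (e : R) : f (e *: h + x + a) = f (e *: h + (x + a)) by rewrite addrA.
split=> [x _|]; first exact: (derivable_line (line x) (smooth_derivable sf)).
rewrite (_ : (fun x => _) = fun x => 'D_h f (x + a)).
  by apply: (IH (fun x => 'D_h f x)); exact: smooth_derive.
by apply/funext => x; rewrite (derive_line (line x)).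
Qed.

(** Two applications of the mean value theorem, first along [h] to the
    increment of [f] in the direction [k], then along [k] to its derivative. *)
Lemma second_diff f x h k (e : R) : smooth f -> e != 0 -> exists a b : R,
  [/\ `|a| <= `|e|, `|b| <= `|e| &
   f (e *: h + e *: k + x) - f (e *: h + x) - f (e *: k + x) + f x =
   e * e * 'D_k ('D_h f) (a *: h + b *: k + x)].
Proof.
move=> sf e0.
pose g y := f (y + e *: k) - f y.
have sg : smooth g.
  have := smooth_add (smooth_shift (e *: k) sf) (smooth_mul (smooth_cst V (-1)) sf).
  by congr smooth; apply/funext => y; rewrite /g /GRing.add /GRing.mul /= mulN1r.
have [a ha Ea] := smooth_MVT x h sg e0.
have sDf : smooth (fun y => 'D_h f y) by exact: smooth_derive.
have Dg y : 'D_h g y = 'D_h f (y + e *: k) - 'D_h f y.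
  have line (t : R) : f (t *: h + y + e *: k) = f (t *: h + (y + e *: k)).
    by rewrite addrA.
  rewrite /g deriveB; last 2 first.
  - exact: (derivable_line line (smooth_derivable sf)).
  - exact: smooth_derivable.
  by rewrite (derive_line line).
have [b hb Eb] := smooth_MVT (a *: h + x) k sDf e0.
exists a, b; split; [exact: ha|exact: hb|].
have -> : a *: h + b *: k + x = b *: k + (a *: h + x) by rewrite addrA (addrC (b *: k)).
rewrite -mulrA -Eb (addrC (e *: k) (a *: h + x)) -Dg -Ea /g.
have -> : e *: h + e *: k + x = e *: h + x + e *: k by rewrite addrAC.
by rewrite (addrC (e *: k) x) opprB addrA [in RHS]addrAC.
Qed.

(** The second difference is symmetric in the two directions, so both mixed
    derivatives take a common value at points arbitrarily close to [x]; they
    are continuous, hence equal at [x]. *)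
Lemma smooth_schwarz f x h k : smooth f -> 'D_k ('D_h f) x = 'D_h ('D_k f) x.
Proof.
move=> sf; apply/eqP; rewrite -subr_eq0 -normr_eq0.
rewrite eq_le normr_ge0 andbT; apply/ler_addgt0Pr => d d0; rewrite add0r.
have cvg0 (g : V -> R) u v : smooth g -> exists2 r : R, 0 < r &
    forall a b : R, `|a| < r -> `|b| < r -> `|g x - g (a *: u + b *: v + x)| < d / 2.
  move=> sg.
  have cA : (fun z : R * R => g (z.1 *: u + z.2 *: v + x)) z @[z --> (0, 0)] --> g x.
    have -> : g x = g ((0, 0 : R).1 *: u + (0 : R, 0).2 *: v + x).
      by rewrite /= !scale0r !add0r.
    apply: continuous_comp; last exact: smooth_cont.
    apply: continuousD; last exact: cvg_cst.
    by apply: continuousD; apply: continuousZl; [exact: cvg_fst|exact: cvg_snd].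
  move/cvgrPdist_lt : cA => /(_ (d / 2)); rewrite divr_gt0// => /(_ isT).
  move=> /nbhs_ballP[r /= r0 H]; exists r => // a b ar br.
  by apply: (H (a, b)); split; rewrite /ball /= sub0r normrN.
have [r1 r10 H1] := cvg0 _ h k (smooth_derive k (smooth_derive h sf)).
have [r2 r20 H2] := cvg0 _ k h (smooth_derive h (smooth_derive k sf)).
pose e := Num.min r1 r2 / 2.
have e0 : 0 < e by rewrite divr_gt0// lt_min r10.
have eE : `|e| < r1 /\ `|e| < r2.
  rewrite gtr0_norm//; apply/andP; rewrite -lt_min /e ltr_pdivrMr//.
  by rewrite mulr_natr mulr2n ltrDl lt_min r10.
have [a1 [b1 [ha1 hb1 E1]]] := second_diff x h k sf (lt0r_neq0 e0).
have [a2 [b2 [ha2 hb2 E2]]] := second_diff x k h sf (lt0r_neq0 e0).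
have E : 'D_k ('D_h f) (a1 *: h + b1 *: k + x) = 'D_h ('D_k f) (a2 *: k + b2 *: h + x).
  apply: (cancel_quotient (mulf_neq0 (lt0r_neq0 e0) (lt0r_neq0 e0)) E1 E2).
  by rewrite (addrC (e *: h)); congr (_ + _); exact: addrAC.
have A := H1 _ _ (le_lt_trans ha1 eE.1) (le_lt_trans hb1 eE.1).
have B := H2 _ _ (le_lt_trans ha2 eE.2) (le_lt_trans hb2 eE.2).
rewrite E in A; exact: dist_halves A B.
Qed.

End SmoothFunctions.
End Lines.

(** * Integrals over a period depending on a parameter *)

Section Integral.
Variable R : realType.
Implicit Types (f g : R -> R).

(** The functional underlying [cint], for integrands not known to be smooth
    and periodic. *)
Definition pint f : R := \int[lebesgue_measure]_(x in `[0, 2 * pi]) f x.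

Lemma twopi_gt0 : 0 < 2 * pi :> R.
Proof. by rewrite mulr_gt0// pi_gt0. Qed.

Lemma cont_integrable f : continuous f ->
  lebesgue_measure.-integrable `[0, 2 * pi] (EFin \o f).
Proof.
move=> cf; apply: continuous_compact_integrable; first exact: segment_compact.
exact: continuous_subspaceT.
Qed.

Lemma pintD f g : continuous f -> continuous g ->
  pint (fun x => f x + g x) = pint f + pint g.
Proof. by move=> cf cg; rewrite /pint RintegralD//; exact: cont_integrable. Qed.

Lemma pintB f g : continuous f -> continuous g ->
  pint (fun x => f x - g x) = pint f - pint g.
Proof. by move=> cf cg; rewrite /pint RintegralB//; exact: cont_integrable. Qed.

Lemma pintZ (c : R) f : continuous f -> pint (fun x => c * f x) = c * pint f.
Proof. by move=> cf; rewrite /pint RintegralZl//; exact: cont_integrable. Qed.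

Lemma pint_bound f (d : R) : continuous f ->
  (forall x : R, x \in `[0, 2 * pi] -> `|f x| <= d) -> `|pint f| <= 2 * pi * d.
Proof.
move=> cf fd; rewrite (le_trans (le_normr_Rintegral _ (cont_integrable cf)))//.
have -> : 2 * pi * d = \int[lebesgue_measure]_(x in `[0, 2 * pi]) (cst d x).
  rewrite Rintegral_cst// mulrC; congr (d * _).
  have := lebesgue_measure_itv `[0, 2 * pi : R].
  by rewrite /= lte_fin twopi_gt0 -EFinB subr0 => ->.
apply: le_Rintegral => //=.
- apply: cont_integrable => x; apply: continuous_comp; first exact: cf.
  exact: norm_continuous.
- by apply: cont_integrable => x; exact: cvg_cst.
Qed.

Lemma pint_FTC f g : continuous g -> (forall x : R, is_derive x 1 f (g x)) ->
  pint g = f (2 * pi) - f 0.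
Proof.
move=> cg fg.
have cf : continuous f.
  by move=> x; apply/differentiable_continuous/derivable1_diffP; exact: ex_derive.
rewrite /pint /Rintegral (@continuous_FTC2 _ _ f)//.
- exact: twopi_gt0.
- exact: continuous_subspaceT.
- split=> [x _|//|//].
  + by [].
  + by apply: cvg_at_right_filter; exact: cf.
  + by apply: cvg_at_left_filter; exact: cf.
- by move=> x _; rewrite derive1E; exact: derive_val.
Qed.

End Integral.

Lemma continuous_pair (T U W : topologicalType) (f : T -> U) (g : T -> W) :
  continuous f -> continuous g -> continuous (fun x => (f x, g x)).
Proof. by move=> cf cg x; apply: cvg_pair; [exact: cf|exact: cg]. Qed.

Section ParamIntegral.
Variables (R : realType) (V : normedModType R).
Implicit Types F : V * R -> R.

(** The tube lemma: continuity is uniform along the compact period. *)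
Lemma uniform_near F s (d : R) : continuous F -> 0 < d ->
  \forall s' \near s, forall y : R, y \in `[0, 2 * pi] -> `|F (s, y) - F (s', y)| < d.
Proof.
move=> cF d0.
have /compact_near_coveringP/(_ V (nbhs s) (fun s' y => `|F (s, y) - F (s', y)| < d)) :=
  @segment_compact R 0 (2 * pi).
move=> /(_ _ _); apply => x _.
have /cvgrPdist_lt/(_ (d / 2)) := cF (s, x).
rewrite divr_gt0// => /(_ isT) H.
have [[/= A B] [sA sB] AB] := H.
exists (B, A) => //= -[y s'] [/= By As'].
rewrite (le_lt_trans (ler_distD (F (s, x)) _ _))// (splitr d) ltrD//.
  rewrite distrC; apply: (AB (s, y)); split=> //=; exact: nbhs_singleton.
exact: (AB (s', y)).
Qed.

Lemma cont_slice F s : continuous F -> continuous (fun y => F (s, y)).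
Proof.
move=> cF y; apply: continuous_comp; last exact: cF.
apply: (@continuous_pair R V R (cst s) id); last by move=> z; exact: cvg_id.
by move=> z; exact: cvg_cst.
Qed.

Lemma cont_sliceB F s s' : continuous F -> continuous (fun y => F (s, y) - F (s', y)).
Proof.
move=> cF y; apply: (cvgB (f := fun y => F (s, y)) (g := fun y => F (s', y))).
  by apply: cont_slice.
by apply: cont_slice.
Qed.

Lemma pint_continuous F : continuous F -> continuous (fun s => pint (fun y => F (s, y))).
Proof.
move=> cF s; apply/cvgrPdist_lt => d d0.
have p0 := twopi_gt0 R.
have d'0 : 0 < d / 2 / (2 * pi) by rewrite !divr_gt0.
have U := uniform_near s cF d'0.
near=> s'.
rewrite -pintB; [|exact: cont_slice..].
rewrite (@le_lt_trans _ _ (2 * pi * (d / 2 / (2 * pi))))//.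
  apply: pint_bound.
    by move=> y; apply: continuousB; exact: cont_slice.
  by move=> y yI; apply: ltW; apply: (near U s').
by rewrite mulrC divfK ?gt_eqF// ltr_pdivrMr// ltr_pMr// ltr1n.
Unshelve. all: by end_near. Qed.

(** By the mean value theorem the difference quotient of [F] in the direction
    [(h, 0)] is a value of its directional derivative at a nearby parameter,
    and this converges uniformly in [y] by the tube lemma. *)
Lemma pint_derive F s h : smooth F ->
  is_derive s h (fun s => pint (fun y => F (s, y)))
    (pint (fun y => 'D_((h, 0) : V * R) F (s, y))).
Proof.
move=> sF.
have cF := smooth_cont sF.
have cD : continuous (fun z => 'D_((h, 0) : V * R) F z).
  exact/smooth_cont/smooth_derive.
have p0 := twopi_gt0 R.
suff H : (fun e : R => e^-1 *: (((fun s => pint (fun y => F (s, y))) \o shift s) (e *: h)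
     - pint (fun y => F (s, y)))) e @[e --> 0^'] -->
    pint (fun y => 'D_((h, 0) : V * R) F (s, y)).
  by split; [apply/cvg_ex; eexists; exact: H|exact: cvg_lim H].
apply/cvgrPdist_lt => d d0.
have d'0 : 0 < d / 2 / (2 * pi) by rewrite !divr_gt0.
have := uniform_near s cD d'0.
have cl : (fun e : R => e *: h + s) e @[e --> 0] --> s.
  have c : continuous (fun e : R => e *: h + s).
    move=> t; apply: cvgD; last exact: cvg_cst.
    by apply: cvgZr_tmp; exact: cvg_id.
  by have := c 0; rewrite /continuous_at scale0r add0r.
move=> /cl/nbhs_ballP[r /= r0 H].
near=> e.
have e0 : e != 0 by near: e; exact: nbhs_dnbhs_neq.
have er : `|e| < r by near: e; exact: dnbhs0_lt.
have cS : continuous (fun y => e^-1 * (F (e *: h + s, y) - F (s, y))).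
  by move=> y; apply: cvgM; [exact: cvg_cst|apply: cont_sliceB].
have -> : e^-1 *: (((fun s => pint (fun y => F (s, y))) \o shift s) (e *: h)
    - pint (fun y => F (s, y))) = pint (fun y => e^-1 * (F (e *: h + s, y) - F (s, y))).
  rewrite pintZ; last by apply: cont_sliceB.
  by rewrite (pintB (cont_slice (s := e *: h + s) cF) (cont_slice (s := s) cF)).
rewrite -(pintB (cont_slice (s := s) cD) cS).
rewrite (@le_lt_trans _ _ (2 * pi * (d / 2 / (2 * pi))))//; last first.
  by rewrite mulrC divfK ?gt_eqF// ltr_pdivrMr// ltr_pMr// ltr1n.
apply: pint_bound.
  move=> y; apply: (cvgB (f := fun y => 'D_((h, 0) : V * R) F (s, y))); last exact: cS.
  by apply: (cont_slice (F := fun z => 'D_((h, 0) : V * R) F z)).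
move=> y yI; apply: ltW.
have [c ce Ec] := smooth_MVT (s, y) ((h, 0) : V * R) sF e0.
have E (t : R) : t *: ((h, 0) : V * R) + (s, y) = (t *: h + s, y).
  by congr pair; rewrite /= scaler0 add0r.
rewrite !E in Ec; rewrite Ec mulrA mulVf// mul1r.
by apply: H => //=; rewrite -ball_normE /ball_ /= sub0r normrN (le_lt_trans ce).
Unshelve. all: by end_near. Qed.

Lemma pint_smooth F : smooth F -> smooth (fun s => pint (fun y => F (s, y))).
Proof.
move=> sF k; elim: k F sF => [|k IH] F sF.
  by split=> // x _; apply: pint_continuous; exact: smooth_cont.
split=> [x _|h]; first by apply: pint_continuous; exact: smooth_cont.
split=> [x _|]; first by have [] := pint_derive x h sF.
rewrite (_ : (fun x => _) = fun s => pint (fun y => 'D_((h, 0) : V * R) F (s, y))).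
  exact: (IH (fun z => 'D_((h, 0) : V * R) F z) (smooth_derive (h, 0) sF)).
by apply/funext => x; have [] := pint_derive x h sF.
Qed.

End ParamIntegral.

(** * Finite-dimensional parameter spaces *)

Section Clinear.
Variable R : realType.
Implicit Types U V W : normedModType R.

Lemma clinear_comp U V W (L : V -> W) (M : U -> V) :
  clinear L -> clinear M -> clinear (L \o M).
Proof.
move=> [cL lL] [cM lM]; split=> [x|e v x /=]; last by rewrite lM lL.
by apply: continuous_comp; [exact: cM|exact: cL].
Qed.

Lemma clinear_pair U V W (L : U -> V) (M : U -> W) :
  clinear L -> clinear M -> clinear (fun x => (L x, M x)).
Proof.
move=> [cL lL] [cM lM]; split=> [|e v x]; last by rewrite lL lM.
exact: continuous_pair.
Qed.

Lemma clinear_fst V W : clinear (fst : V * W -> V).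
Proof. by split=> // x; exact: cvg_fst. Qed.

Lemma clinear_snd V W : clinear (snd : V * W -> W).
Proof. by split=> // x; exact: cvg_snd. Qed.

Lemma clinear_id V : clinear (id : V -> V).
Proof. by split=> // x; exact: cvg_id. Qed.

Lemma clinear0 V W : clinear (fun _ : V => 0 : W).
Proof. by split=> [x|*]; [exact: cvg_cst|rewrite scaler0 addr0]. Qed.

Lemma clinearD V W (L M : V -> W) :
  clinear L -> clinear M -> clinear (fun x => L x + M x).
Proof.
move=> [cL lL] [cM lM]; split=> [x|e v x].
  by apply: cvgD; [exact: cL|exact: cM].
by rewrite lL lM scalerDr addrACA.
Qed.

Lemma continuous_mx (T : topologicalType) m n (f : T -> 'M[R]_(m, n)) :
  (forall i j, continuous (fun t => f t i j)) -> continuous f.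
Proof.
move=> cf t; apply/cvgrPdist_lt => e e0.
have H : \forall t' \near t, forall i j, `|f t i j - f t' i j| < e.
  apply: filter_forall => i; apply: filter_forall => j.
  by have /cvgrPdist_lt := cf i j t; exact.
near=> t'.
rewrite /Num.Def.normr/= mx_normrE; apply: bigmax_lt => //= -[i j] _ /=.
by rewrite !mxE; apply: (near H t').
Unshelve. all: by end_near. Qed.

Lemma clinear_mx V m n (f : V -> 'M[R]_(m, n)) :
  (forall i j, clinear (fun t => f t i j)) -> clinear f.
Proof.
move=> cf; split; first by apply: continuous_mx => i j; exact: (cf i j).1.
by move=> e v x; apply/matrixP => i j; rewrite !mxE (cf i j).2.
Qed.

Lemma clinear_coord m n i j : clinear (fun M : 'M[R]_(m, n) => M i j).
Proof. by split=> [|e v x]; [exact: coord_continuous|rewrite !mxE]. Qed.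

(** Smoothness of functionals is tested on families parametrized by row
    vectors; a retract of a space of row vectors can be used just as well.
    Being a retract is easier to establish than being isomorphic, and is
    preserved by adding one more real parameter. *)
Definition fin_dim V := exists n (a : V -> 'rV[R]_n) (b : 'rV[R]_n -> V),
  [/\ clinear a, clinear b & cancel a b].

Lemma fin_dim_rV n : fin_dim 'rV[R]_n.
Proof. by exists n, id, id; split=> //; exact: clinear_id. Qed.

Lemma fin_dimX V : fin_dim V -> fin_dim (V * R)%type.
Proof.
move=> [n [a [b [la lb ab]]]].
exists (n + 1)%N, (fun z => row_mx (a z.1) (const_mx z.2)),
  (fun M => (b (lsubmx M), rsubmx M 0 0)).
split.
- apply: clinear_mx => i j.
  case: (splitP j) => k jk.
    have -> : (fun t : V * R => row_mx (a t.1) (const_mx t.2) i j) =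
        (fun M : 'rV[R]_n => M i k) \o a \o fst.
      apply/funext => t /=; have -> : j = lshift 1 k by exact: val_inj.
      by rewrite row_mxEl.
    apply: clinear_comp; last exact: clinear_fst.
    by apply: clinear_comp => //; exact: clinear_coord.
  have -> : (fun t : V * R => row_mx (a t.1) (const_mx t.2) i j) = snd.
    apply/funext => t /=; have -> : j = rshift n k by exact: val_inj.
    by rewrite row_mxEr mxE.
  exact: clinear_snd.
- apply: clinear_pair.
    apply: (clinear_comp lb); apply: clinear_mx => i j.
    have -> : (fun t : 'rV[R]_(n + 1) => lsubmx t i j) = fun t => t i (lshift 1 j).
      by apply/funext => t; rewrite mxE.
    exact: clinear_coord.
  have -> : (fun t : 'rV[R]_(n + 1) => rsubmx t 0 0) = fun t => t 0 (rshift n 0).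
    by apply/funext => t; rewrite mxE.
  exact: clinear_coord.
- by move=> [v r]; rewrite row_mxKl row_mxKr ab mxE.
Qed.

Lemma fin_dim_retract V W (a : V -> W) (b : W -> V) :
  clinear a -> clinear b -> cancel a b -> fin_dim W -> fin_dim V.
Proof.
move=> la lb ab [n [a' [b' [la' lb' ab']]]].
exists n, (a' \o a), (b \o b'); split; [exact: clinear_comp..|].
by move=> x /=; rewrite ab' ab.
Qed.

Lemma fin_dimR : fin_dim R.
Proof.
(* Adding one parameter to the zero-dimensional space. *)
apply: (@fin_dim_retract R ('rV[R]_0 * R)%type (fun x => (0, x)) snd) => //.
- by apply: clinear_pair; [exact: clinear0|exact: clinear_id].
- exact: clinear_snd.
- by apply: fin_dimX; exact: fin_dim_rV.
Qed.

(** Both functions are differentiable, and each derivative is a multiple of the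
    other function, so differentiability of all orders follows by a
    simultaneous induction. *)
Lemma smooth_ode2 (f g : R -> R) (k : R) :
  (forall x : R, is_derive x 1 f (g x)) -> (forall x : R, is_derive x 1 g (k * f x)) ->
  smooth f.
Proof.
move=> fg gf.
suff H n : Ck_on setT n f /\ Ck_on setT n g by move=> n; exact: (H n).1.
have scale (u v : R -> R) (h x : R) : is_derive x 1 u (v x) ->
    is_derive x h u (h * v x).
  move=> [du <-].
  have line (t : R) : u (t *: h + x) = u ((t * h) *: 1 + x) by rewrite [_ *: 1]mulr1.
  have uD : differentiable u x by exact/derivable1_diffP.
  split; first exact: diff_derivable.
  rewrite !deriveE// -[X in 'd u x X = _](mulr1 h).
  exact: linearZ.
have cont (u v : R -> R) : (forall x : R, is_derive x 1 u (v x)) -> continuous u.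
  move=> uv x; apply/differentiable_continuous/derivable1_diffP.
  by have [] := uv x.
elim: n => [|n [IHf IHg]].
  by split; split=> // x _; [exact: (cont f g)|exact: (cont g (fun x => k * f x))].
split; split.
- by move=> x _; exact: (cont f g).
- move=> h; split=> [x _|]; first by have [] := scale f g h x (fg x).
  rewrite (_ : (fun x => _) = cst h * g); first by apply: Ck_mul => //; exact: Ck_cst.
  by apply/funext => x; have [_ ->] := scale f g h x (fg x).
- by move=> x _; exact: (cont g (fun x => k * f x)).
- move=> h; split=> [x _|].
    by have [] := scale g (fun x => k * f x) h x (gf x).
  rewrite (_ : (fun x => _) = cst (h * k) * f).
    by apply: Ck_mul => //; exact: Ck_cst.
  apply/funext => x; have [_ ->] := scale g (fun x => k * f x) h x (gf x).
  by rewrite mulrA.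
Qed.

End Clinear.

(** * Calculus on the circle *)

Section Deriv.
Variables (R : realType) (V : normedModType R).
Implicit Types (f g : V -> R) (x h : V).

(** [is_derive] is a class: stating goals with it triggers a search through the
    differentiation rules, which is very costly on functions on the circle.
    This constant hides it from the search. *)
Definition has_deriv f x h (df : R) : Prop := is_derive x h f df.

Lemma has_derivE f x h df : has_deriv f x h df -> 'D_h f x = df.
Proof. by case. Qed.

Lemma has_deriv_ext f g x h (df dg : R) :
  (forall s, f s = g s) -> df = dg -> has_deriv g x h dg -> has_deriv f x h df.
Proof. by move=> fg -> ; have -> : f = g by exact/funext. Qed.

Lemma has_derivM f g x h (df dg : R) :
  has_deriv f x h df -> has_deriv g x h dg ->
  has_deriv (fun s => f s * g s) x h (df * g x + f x * dg).
Proof.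
move=> vf vg; apply: (has_deriv_ext _ _ (is_deriveM vf vg)) => //.
by rewrite addrC; congr (_ + _); exact: mulrC.
Qed.

Lemma has_derivD f g x h (df dg : R) :
  has_deriv f x h df -> has_deriv g x h dg ->
  has_deriv (fun s => f s + g s) x h (df + dg).
Proof. by move=> vf vg; exact: is_deriveD vf vg. Qed.

Lemma has_derivZ c f x h (df : R) :
  has_deriv f x h df -> has_deriv (fun s => c * f s) x h (c * df).
Proof. by move=> vf; exact: is_deriveZ vf. Qed.

Lemma has_deriv_cst (c : R) x h : has_deriv (fun=> c) x h 0.
Proof. exact: is_derive_cst. Qed.

Lemma smooth_has_deriv f x h : smooth f -> has_deriv f x h ('D_h f x).
Proof. by move=> sf; split=> //; exact: smooth_derivable. Qed.

End Deriv.

Section CircCalculus.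
Variable R : realType.
Implicit Types f g u v : circ R.

Lemma circ_smooth u : smooth u.
Proof. exact: (elimT (circ_predP _) (valP u)).1. Qed.

Lemma circ_periodic u x : u (x + 2 * pi) = u x.
Proof. exact: (elimT (circ_predP _) (valP u)).2. Qed.

Lemma circ_continuous u : continuous u.
Proof. exact/smooth_cont/circ_smooth. Qed.

Lemma circ_ext u v : (forall x, u x = v x) -> u = v.
Proof. by move=> uv; apply: val_inj; apply/funext. Qed.

Lemma circDE u v x : (u + v) x = u x + v x. Proof. by []. Qed.
Lemma circNE u x : (- u) x = - u x. Proof. by []. Qed.
Lemma circME u v x : (u * v) x = u x * v x. Proof. by []. Qed.
Lemma circZE (c : R) u x : (c *: u) x = c * u x. Proof. by []. Qed.
Lemma circ1E x : (1 : circ R) x = 1. Proof. by []. Qed.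
Lemma circ0E x : (0 : circ R) x = 0. Proof. by []. Qed.

Definition has_Dx u v := forall x : R, has_deriv u x 1 (v x).

Lemma DxP u : has_Dx u (Dx u).
Proof.
by move=> x; rewrite /= derive1E; apply: smooth_has_deriv; exact: circ_smooth.
Qed.

Lemma Dx_unique u v : has_Dx u v -> Dx u = v.
Proof.
by move=> uv; apply: circ_ext => x; rewrite [LHS]derive1E (has_derivE (uv x)).
Qed.

Lemma DxD u v : Dx (u + v) = Dx u + Dx v.
Proof.
apply: Dx_unique => x.
exact: (has_deriv_ext (circDE u v) (circDE _ _ x) (has_derivD (DxP u x) (DxP v x))).
Qed.

Lemma DxZ (c : R) u : Dx (c *: u) = c *: Dx u.
Proof.
apply: Dx_unique => x.
exact: (has_deriv_ext (circZE c u) (circZE _ _ x) (has_derivZ c (DxP u x))).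
Qed.

Lemma DxM u v : Dx (u * v) = Dx u * v + u * Dx v.
Proof.
apply: Dx_unique => x.
apply: (has_deriv_ext (circME u v) (circDE (Dx u * v) (u * Dx v) x)).
rewrite !circME; exact: (has_derivM (DxP u x) (DxP v x)).
Qed.

Lemma Dx_cst (c : R) : Dx (c *: (1 : circ R)) = 0.
Proof.
apply: Dx_unique => x; apply: (has_deriv_ext _ (circ0E x) (has_deriv_cst c x 1)).
by move=> s; rewrite circZE circ1E mulr1.
Qed.

Lemma DxN u : Dx (- u) = - Dx u.
Proof. by rewrite -[- u]scaleN1r DxZ scaleN1r. Qed.

Lemma DxB u v : Dx (u - v) = Dx u - Dx v.
Proof. by rewrite DxD DxN. Qed.

Lemma cintD u v : cint (u + v) = cint u + cint v.
Proof. exact: (@pintD R u v (@circ_continuous u) (@circ_continuous v)). Qed.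

Lemma cintZ (c : R) u : cint (c *: u) = c * cint u.
Proof. exact: (@pintZ R c u (@circ_continuous u)). Qed.

Lemma cintN u : cint (- u) = - cint u.
Proof. by rewrite -[- u]scaleN1r cintZ mulN1r. Qed.

Lemma cintB u v : cint (u - v) = cint u - cint v.
Proof. by rewrite cintD cintN. Qed.

Lemma cint_Dx u : cint (Dx u) = 0.
Proof.
rewrite [LHS](@pint_FTC _ u (Dx u)); last by move=> x; exact: (DxP u x).
  by have := circ_periodic u 0; rewrite add0r => ->; rewrite subrr.
exact: circ_continuous.
Qed.

Lemma cint_parts u v : cint (Dx u * v) = - cint (u * Dx v).
Proof. by apply/eqP; rewrite -addr_eq0 -cintD -DxM cint_Dx. Qed.

End CircCalculus.

(** * Smooth families of functions on the circle *)

Section Families.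
Variables (R : realType).
Implicit Types V W : normedModType R.

(** Joint smoothness in the parameter and in the point of the circle. *)
Definition fam V (p : V -> circ R) := smooth (fun z : V * R => p z.1 z.2).

Lemma smooth_familyP V (p : V -> circ R * R) : smooth_family setT p <->
  fam (fun s => (p s).1) /\ smooth (fun s => (p s).2).
Proof. by rewrite /smooth_family setXTT. Qed.

Section Closure.
Variable V : normedModType R.
Implicit Types p q : V -> circ R.

Lemma fam_comp W (L : W -> V) p : clinear L -> fam p -> fam (p \o L).
Proof.
move=> lL; have lM : clinear (fun z : W * R => (L z.1, z.2)).
  apply: clinear_pair; last exact: clinear_snd.
  by apply: clinear_comp lL _; exact: clinear_fst.
exact: smooth_lin lM.
Qed.

Lemma fam_cst u : fam (fun _ : V => u).
Proof. exact: (smooth_lin (@clinear_snd R V R) (circ_smooth u)). Qed.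

Lemma famD p q : fam p -> fam q -> fam (fun s => p s + q s).
Proof. exact: smooth_add. Qed.

Lemma famM p q : fam p -> fam q -> fam (fun s => p s * q s).
Proof. exact: smooth_mul. Qed.

Lemma famZ (a : V -> R) p : smooth a -> fam p -> fam (fun s => a s *: p s).
Proof. by move=> sa; apply: smooth_mul; exact: smooth_lin (@clinear_fst R V R) sa. Qed.

Lemma famN p : fam p -> fam (fun s => - p s).
Proof.
move=> fp; under eq_fun do rewrite -scaleN1r.
exact: (famZ (smooth_cst V (-1)) fp).
Qed.

Lemma famB p q : fam p -> fam q -> fam (fun s => p s - q s).
Proof. by move=> fp fq; apply: famD => //; exact: famN. Qed.

Lemma Dx_joint p s (x : R) :
  Dx (p s) x = 'D_((0, 1) : V * R) (fun z => p z.1 z.2) (s, x).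
Proof.
rewrite [LHS]derive1E; apply: derive_line => e /=.
by rewrite scaler0 add0r.
Qed.

Lemma fam_Dx p : fam p -> fam (fun s => Dx (p s)).
Proof.
move=> fp; rewrite /fam; under eq_fun do rewrite Dx_joint.
rewrite (_ : (fun x => _) = fun z => 'D_((0, 1) : V * R) (fun z => p z.1 z.2) z).
  exact: smooth_derive.
by apply/funext => -[].
Qed.

Lemma fam_cint p : fam p -> smooth (fun s => cint (p s)).
Proof. exact: pint_smooth. Qed.

End Closure.

Definition is_vel (p : R -> circ R) (t : R) (q : circ R) :=
  forall x, has_deriv (fun s => p s x) t 1 (q x).

Implicit Types (p q : R -> circ R) (a : R -> R) (t : R).

Lemma is_vel_cst u t : is_vel (fun=> u) t 0.
Proof. by move=> x; exact: has_deriv_cst. Qed.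

Lemma is_velD p q t dp dq : is_vel p t dp -> is_vel q t dq ->
  is_vel (fun s => p s + q s) t (dp + dq).
Proof. by move=> vp vq x; exact: (has_derivD (vp x) (vq x)). Qed.

Lemma is_velM p q t dp dq : is_vel p t dp -> is_vel q t dq ->
  is_vel (fun s => p s * q s) t (dp * q t + p t * dq).
Proof. by move=> vp vq x; exact: (has_derivM (vp x) (vq x)). Qed.

Lemma is_velN p t dp : is_vel p t dp -> is_vel (fun s => - p s) t (- dp).
Proof.
move=> vp x; apply: (has_deriv_ext _ _ (has_derivZ (-1) (vp x))) => [s|];
  by rewrite mulN1r.
Qed.

Lemma vel_joint p t x :
  'D_1 (fun s => p s x) t = 'D_((1, 0) : R * R) (fun z => p z.1 z.2) (t, x).
Proof. by apply: derive_line => e /=; rewrite scaler0 add0r. Qed.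

Lemma vel_derivable p t x : fam p -> derivable (fun s => p s x) t 1.
Proof.
move=> fp; have := smooth_derivable (x := (t, x)) (h := (1, 0)) fp.
by apply: derivable_line => e /=; rewrite scaler0 add0r.
Qed.

(** The derivative in time of a jointly smooth curve is again smooth and
    periodic in [x]. *)
Lemma fam_vel p t : fam p -> exists dp, is_vel p t dp.
Proof.
move=> fp; pose G z := 'D_((1, 0) : R * R) (fun z => p z.1 z.2) z.
have sG : smooth G by exact: smooth_derive.
have pG x : 'D_1 (fun s => p s x) t = G (t, x) by exact: vel_joint.
clearbody G.
have qc : (fun x => G (t, x)) \in @circ_pred R.
  apply/circ_predP; split; last first.
    move=> x; rewrite -(pG x) -(pG (x + _)).
    by under eq_fun do rewrite circ_periodic.
  have L : clinear (fun x : R => (0, x) : R * R).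
    by apply: clinear_pair; [exact: clinear0|exact: clinear_id].
  have E x : G (t, x) = G ((0, x) + (t, 0)).
    by congr G; congr pair; rewrite /= ?add0r ?addr0.
  under eq_fun do rewrite E.
  exact: (smooth_lin L (smooth_shift (t, 0) sG)).
exists (Circ qc) => x; split; first exact: (@vel_derivable p t x fp).
exact: pG.
Qed.

(** Derivatives in time and in space commute, by the symmetry of second
    derivatives of the joint function. *)
Lemma is_vel_Dx p t dp : fam p -> is_vel p t dp ->
  is_vel (fun s => Dx (p s)) t (Dx dp).
Proof.
move=> fp vp x; split; first exact: (@vel_derivable (fun s => Dx (p s)) t x (fam_Dx fp)).
rewrite (vel_joint (fun s => Dx (p s))).
rewrite (_ : (fun z : R * R => _) =
  fun z => 'D_((0, 1) : R * R) (fun z => p z.1 z.2) z); last first.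
  by apply/funext => -[y1 y2]; exact: Dx_joint.
rewrite [LHS](smooth_schwarz _ _ _ fp) [RHS]derive1E; apply: esym.
apply: derive_line => e.
have -> : e *: ((0, 1) : R * R) + (t, x) = (t, e *: 1 + x).
  by congr pair; rewrite /= scaler0 add0r.
by rewrite -vel_joint (has_derivE (vp _)).
Qed.

Lemma is_vel_cint p t dp : fam p -> is_vel p t dp ->
  has_deriv (fun s => cint (p s)) t 1 (cint dp).
Proof.
move=> fp vp; apply: (has_deriv_ext _ _ (pint_derive t 1 fp)) => //.
congr pint; apply/funext => x.
by rewrite -(has_derivE (vp x)) -vel_joint.
Qed.

End Families.

(** * The Virasoro bracket and its coadjoint action *)

Section VirAlgebra.
Variable R : realType.
Implicit Types (X Y Z : vir R) (m : vir_dual R) (u v w : circ R).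

(** Scalars as constant functions, so that identities between functions on the
    circle can be proved by [ring]. *)
Lemma scale_circE (c : R) u : c *: u = (c *: (1 : circ R)) * u.
Proof. by apply: circ_ext => x; rewrite circME !circZE circ1E mulr1. Qed.

Lemma cint_parts3 u v : cint (Dx (Dx (Dx u)) * v) = - cint (u * Dx (Dx (Dx v))).
Proof. by rewrite !cint_parts !opprK. Qed.

(** The central component is antisymmetric since three integrations by parts
    produce the sign [-1]. *)
Lemma vbracket_anti X Y : vbracket X Y = - vbracket Y X.
Proof.
congr pair => /=; first by ring.
by rewrite -cint_parts3 mulrC.
Qed.

(** For the central component, moving the three derivatives to the outer
    argument turns the cyclic sum into the integral of the determinant with
    rows [(f, f', f''')] for f = u, v, w.  It is the derivative of the Wronskian
    determinant, with rows [(f, f', f'')], so its integral vanishes. *)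
Lemma vbracket_jacobi X Y Z :
  vbracket X (vbracket Y Z) + vbracket Y (vbracket Z X) + vbracket Z (vbracket X Y) = 0.
Proof.
case: X Y Z => [u a] [v b] [w c].
congr pair => /=; first by rewrite !(DxD, DxN, DxM); ring.
have P (p q : circ R) : cint (p * Dx (Dx (Dx q))) = - cint (Dx (Dx (Dx p)) * q).
  by rewrite cint_parts3 opprK.
rewrite !P -!opprD -!cintD.
rewrite (_ : _ + _ + _ = Dx (Dx (Dx u) * (Dx v * w - v * Dx w)
   + Dx (Dx v) * (Dx w * u - w * Dx u) + Dx (Dx w) * (Dx u * v - u * Dx v))).
  by rewrite cint_Dx oppr0.
by rewrite !(DxD, DxN, DxM); ring.
Qed.

Lemma vir_ext X Y : X.1 = Y.1 -> X.2 = Y.2 -> X = Y.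
Proof. by case: X Y => [u a] [v b] /= -> ->. Qed.

Lemma vbracketZl (c : R) X Y : vbracket (c *: X) Y = c *: vbracket X Y.
Proof.
apply: vir_ext.
  change (- ((c *: X.1) * Dx Y.1) + Dx (c *: X.1) * Y.1 =
    c *: (- (X.1 * Dx Y.1) + Dx X.1 * Y.1)).
  by rewrite DxZ (scale_circE c X.1) (scale_circE c (Dx X.1)) [in RHS]scale_circE; ring.
change (cint ((c *: X.1) * Dx (Dx (Dx Y.1))) = c * cint (X.1 * Dx (Dx (Dx Y.1)))).
by rewrite -cintZ (scale_circE c X.1) [in RHS]scale_circE mulrA.
Qed.

Lemma pairingDr m X Y : pairing m (X + Y) = pairing m X + pairing m Y.
Proof.
change (cint (m.1 * (X.1 + Y.1)) + m.2 * (X.2 + Y.2) =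
  (cint (m.1 * X.1) + m.2 * X.2) + (cint (m.1 * Y.1) + m.2 * Y.2)).
by rewrite mulrDr cintD mulrDr addrACA.
Qed.

Lemma pairingC m X : pairing m X = pairing (X : vir_dual R) (m : vir R).
Proof. by rewrite /pairing mulrC (mulrC m.2). Qed.

Lemma pairingDl m m' X : pairing (m + m') X = pairing m X + pairing m' X.
Proof. by rewrite pairingC pairingDr (pairingC X m) (pairingC X m'). Qed.

Lemma pairingZr m (c : R) X : pairing m (c *: X) = c * pairing m X.
Proof.
change (cint (m.1 * (c *: X.1)) + m.2 * (c * X.2) = c * (cint (m.1 * X.1) + m.2 * X.2)).
rewrite mulrDr -cintZ (scale_circE c X.1) (scale_circE c (_ * _)) mulrCA.
by rewrite (mulrCA m.2).
Qed.

Lemma pairingZl m (c : R) X : pairing (c *: m) X = c * pairing m X.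
Proof. by rewrite pairingC pairingZr pairingC. Qed.

Lemma pairingNr m X : pairing m (- X) = - pairing m X.
Proof. by rewrite -(scaleN1r X) pairingZr mulN1r. Qed.

(** The coadjoint action [v u_x + 2 u v_x - a v_xxx], obtained from the bracket
    by integration by parts; its central component vanishes. *)
Definition coad X m : vir_dual R :=
  (Dx m.1 * X.1 + (m.1 + m.1) * Dx X.1 - m.2 *: Dx (Dx (Dx X.1)), 0).

Lemma cint_coad (a : R) u v w :
  cint ((Dx u * v + (u + u) * Dx v - a *: Dx (Dx (Dx v))) * w) =
  cint (u * (- (v * Dx w) + Dx v * w)) + a * cint (v * Dx (Dx (Dx w))).
Proof.
rewrite -cintZ -cintD; apply/eqP; rewrite -subr_eq0 -cintB; apply/eqP.
rewrite (scale_circE a (Dx (Dx (Dx v)))) (scale_circE a (v * _)).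
rewrite (_ : _ - _ = Dx (u * v * w)
   - (a *: (1 : circ R)) * Dx (Dx (Dx v) * w - Dx v * Dx w + v * Dx (Dx w))).
  by rewrite cintB -scale_circE cintZ !cint_Dx mulr0 subrr.
by rewrite !(DxD, DxN, DxM); ring.
Qed.

Lemma coadP X m : is_coad X m (coad X m).
Proof.
move=> Y; rewrite /pairing /coad /vbracket /= mul0r addr0.
exact: cint_coad.
Qed.

End VirAlgebra.

Section VirFamilies.
Variable R : realType.
Variable V : normedModType R.
Implicit Types p q N X Y : V -> (circ R * R)%type.

Lemma sfamD p q : smooth_family setT p -> smooth_family setT q ->
  smooth_family setT (fun s => p s + q s).
Proof.
move=> /smooth_familyP[p1 p2] /smooth_familyP[q1 q2]; apply/smooth_familyP; split.
  exact: (famD p1 q1).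
exact: (smooth_add p2 q2).
Qed.

Lemma sfamZ (a : V -> R) p : smooth a -> smooth_family setT p ->
  smooth_family setT (fun s => a s *: p s).
Proof.
move=> sa /smooth_familyP[p1 p2]; apply/smooth_familyP; split.
  exact: (famZ sa p1).
exact: (smooth_mul sa p2).
Qed.

Lemma sfam_cst (u : circ R * R) : smooth_family setT (fun _ : V => u).
Proof.
apply/smooth_familyP; split; first exact: (@fam_cst R V u.1).
exact: (@smooth_cst R V u.2).
Qed.

Lemma sfam_comp (W : normedModType R) (L : W -> V) p : clinear L ->
  smooth_family setT p -> smooth_family setT (p \o L).
Proof.
move=> lL /smooth_familyP[p1 p2]; apply/smooth_familyP; split.
  exact: (fam_comp lL p1).
exact: (smooth_lin lL p2).
Qed.

Lemma sfam_pairing N X : smooth_family setT N -> smooth_family setT X ->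
  smooth (fun s => pairing (N s) (X s)).
Proof.
move=> /smooth_familyP[p1 p2] /smooth_familyP[q1 q2].
exact: (smooth_add (fam_cint (famM p1 q1)) (smooth_mul p2 q2)).
Qed.

Lemma sfam_vbracket X Y : smooth_family setT X -> smooth_family setT Y ->
  smooth_family setT (fun s => vbracket (X s) (Y s)).
Proof.
move=> /smooth_familyP[p1 p2] /smooth_familyP[q1 q2]; apply/smooth_familyP; split.
  exact: (famD (famN (famM p1 (fam_Dx q1))) (famM (fam_Dx p1) q1)).
exact: (fam_cint (famM p1 (fam_Dx (fam_Dx (fam_Dx q1))))).
Qed.

Lemma sfam_coad X N : smooth_family setT X -> smooth_family setT N ->
  smooth_family setT (fun s => coad (X s) (N s)).
Proof.
move=> /smooth_familyP[p1 p2] /smooth_familyP[q1 q2]; apply/smooth_familyP; split.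
  apply: (famB (famD (famM (fam_Dx q1) p1) (famM (famD q1 q1) (fam_Dx p1)))).
  exact: (famZ q2 (fam_Dx (fam_Dx (fam_Dx p1)))).
exact: (@smooth_cst R V 0).
Qed.

End VirFamilies.

Section VirVelocity.
Variable R : realType.
Implicit Types (p q N X Y : R -> (circ R * R)%type) (t : R).

Lemma is_velocity_ex p t : smooth_family setT p -> exists dp, is_velocity p t dp.
Proof.
move=> /smooth_familyP[p1 p2]; have [q vq] := fam_vel t p1.
exists (q, 'D_1 (fun s => (p s).2) t); split; first exact: vq.
exact: (smooth_has_deriv t 1 p2).
Qed.

Lemma is_velocity_line (m h : circ R * R) : is_velocity (fun e => m + e *: h) 0 h.
Proof.
split=> [x|].
  apply: (has_deriv_ext _ _ (is_derive_affine 0 (h.1 x) (m.1 x))) => // s.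
  by rewrite addrC.
apply: (has_deriv_ext _ _ (is_derive_affine 0 h.2 m.2)) => // s.
by rewrite addrC.
Qed.

(** The product rule for a bilinear operation given by integrals: joint
    smoothness of the curves allows differentiation under the integral. *)
Lemma velocity_pairing N X t dN dX :
  smooth_family setT N -> smooth_family setT X ->
  is_velocity N t dN -> is_velocity X t dX ->
  has_deriv (fun s => pairing (N s) (X s)) t 1 (pairing dN (X t) + pairing (N t) dX).
Proof.
move=> /smooth_familyP[p1 p2] /smooth_familyP[q1 q2] [vp1 vp2] [vq1 vq2].
have := has_derivD (is_vel_cint (famM p1 q1) (is_velM vp1 vq1)) (has_derivM vp2 vq2).
apply: has_deriv_ext => //; rewrite /pairing cintD; ring.
Qed.

Lemma velocity_vbracket X Y t dX dY :
  smooth_family setT X -> smooth_family setT Y ->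
  is_velocity X t dX -> is_velocity Y t dY ->
  is_velocity (fun s => vbracket (X s) (Y s)) t (vbracket dX (Y t) + vbracket (X t) dY).
Proof.
move=> /smooth_familyP[p1 p2] /smooth_familyP[q1 q2] [vp1 vp2] [vq1 vq2].
have q2' := fam_Dx (fam_Dx q1); have q3' := fam_Dx q2'.
have vq3 := is_vel_Dx q2' (is_vel_Dx (fam_Dx q1) (is_vel_Dx q1 vq1)).
have E : (- (dX.1 * Dx (Y t).1) + Dx dX.1 * (Y t).1)
      + (- ((X t).1 * Dx dY.1) + Dx (X t).1 * dY.1) =
    - (dX.1 * Dx (Y t).1 + (X t).1 * Dx dY.1)
      + (Dx dX.1 * (Y t).1 + Dx (X t).1 * dY.1) by ring.
split=> [x|].
  have H := is_velD (is_velN (is_velM vp1 (is_vel_Dx q1 vq1)))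
    (is_velM (is_vel_Dx p1 vp1) vq1).
  exact: (has_deriv_ext _ (congr1 (fun u : circ R => u x) E) (H x)).
have := is_vel_cint (famM p1 q3') (is_velM vp1 vq3).
by apply: has_deriv_ext => //; rewrite cintD.
Qed.

End VirVelocity.

(** * Functionals and the derivatives of their gradients *)

Section Functionals.
Variable R : realType.
Implicit Types (V : normedModType R) (f g k : functional R) (m h n : vir_dual R).

Lemma fval_fam V f (p : V -> vir_dual R) : fin_dim V ->
  smooth_family setT p -> smooth (fun s => f (p s)).
Proof.
move=> [d [a [b [la lb ab]]]] sp.
have := smooth_lin la (fval_smooth f (sfam_comp lb sp)).
by congr smooth; apply/funext => s /=; rewrite ab.
Qed.

Lemma grad_fam V f (p : V -> vir_dual R) : fin_dim V ->
  smooth_family setT p -> smooth_family setT (fun s => grad f (p s)).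
Proof.
move=> [d [a [b [la lb ab]]]] sp.
have := sfam_comp la (grad_smooth f (sfam_comp lb sp)).
by congr (smooth_family setT); apply/funext => s /=; rewrite ab.
Qed.

Lemma sfam_line m h : smooth_family setT (fun e : R => m + e *: h).
Proof.
apply: (@sfamD R R (fun=> m)); first exact: (@sfam_cst R R m).
apply: (@sfamZ R R id (fun=> h)); last exact: (@sfam_cst R R h).
exact: (smooth_linear (@clinear_id R R)).
Qed.

Lemma fval_line f m h :
  has_deriv (fun e : R => f (m + e *: h)) 0 1 (pairing h (grad f m)).
Proof. exact: gradP. Qed.

(** Along a line the gradient is a smooth curve in [vir], so its velocity is
    itself an element of [vir]. *)
Lemma grad_line_vel f m h :
  {dp : vir R | is_velocity (fun e : R => grad f (m + e *: h)) 0 dp}.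
Proof. exact/cid/(is_velocity_ex 0 (grad_fam f (@fin_dimR R) (sfam_line m h))). Qed.

(** The directional derivative of the gradient at [m] along [h]; as a function
    of [h] it is the second differential of [f]. *)
Definition hess f m h : vir R := sval (grad_line_vel f m h).

Lemma hessP f m h : is_velocity (fun e : R => grad f (m + e *: h)) 0 (hess f m h).
Proof. exact: svalP (grad_line_vel f m h). Qed.

Lemma addr_scale0 m h : m + (0 : R) *: h = m.
Proof. by rewrite scale0r addr0. Qed.

Lemma pairing_grad_line f m h (l : vir_dual R) :
  has_deriv (fun e : R => pairing h (grad f (m + e *: l))) 0 1 (pairing h (hess f m l)).
Proof.
have v0 : is_velocity (fun _ : R => h) 0 0.
  by split=> [x|]; exact: has_deriv_cst.
have := velocity_pairing (@sfam_cst R R h) (grad_fam f (@fin_dimR R) (sfam_line m l))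
  v0 (hessP f m l).
apply: has_deriv_ext => //.
have -> : pairing 0 (grad f (m + (0 : R) *: l)) = 0.
  by rewrite -(scale0r (0 : vir_dual R)) pairingZl mul0r.
by rewrite add0r.
Qed.

Lemma sfam_plane m (l : vir_dual R) h :
  smooth_family setT (fun z : R * R => m + z.1 *: l + z.2 *: h).
Proof.
apply: (@sfamD R (R * R)%type (fun z => m + z.1 *: l)).
  apply: (@sfamD R (R * R)%type (fun=> m)); first exact: (@sfam_cst R _ m).
  apply: (@sfamZ R (R * R)%type fst (fun=> l)); last exact: (@sfam_cst R _ l).
  exact: (smooth_linear (@clinear_fst R R R)).
apply: (@sfamZ R (R * R)%type snd (fun=> h)); last exact: (@sfam_cst R _ h).
exact: (smooth_linear (@clinear_snd R R R)).
Qed.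

(** Both sides are mixed second derivatives at the origin of the smooth
    function [(s, r) |-> f (m + s l + r h)] of two real variables. *)
Lemma hess_sym f m h (l : vir_dual R) : pairing h (hess f m l) = pairing l (hess f m h).
Proof.
pose phi (z : R * R) := f (m + z.1 *: l + z.2 *: h).
have sphi : smooth phi := fval_fam f (fin_dimX (@fin_dimR R)) (sfam_plane m l h).
have D2 z : 'D_((0, 1) : R * R) phi z = pairing h (grad f (m + z.1 *: l + z.2 *: h)).
  rewrite -(has_derivE (fval_line f _ h)); apply: derive_line => e.
  rewrite /phi; congr (fval f _).
  rewrite addr0 [e *: 1]mulr1 -[RHS]addrA -scalerDl.
  have -> : (e *: ((0, 1) : R * R) + z).1 = z.1 by rewrite /= scaler0 add0r.
  have -> : (e *: ((0, 1) : R * R) + z).2 = z.2 + e by rewrite /= [e *: 1]mulr1 addrC.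
  by [].
have D1 z : 'D_((1, 0) : R * R) phi z = pairing l (grad f (m + z.1 *: l + z.2 *: h)).
  rewrite -(has_derivE (fval_line f _ l)); apply: derive_line => e.
  rewrite /phi; congr (fval f _).
  rewrite addr0 [e *: 1]mulr1.
  have -> : (e *: ((1, 0) : R * R) + z).1 = z.1 + e by rewrite /= [e *: 1]mulr1 addrC.
  have -> : (e *: ((1, 0) : R * R) + z).2 = z.2 by rewrite /= scaler0 add0r.
  rewrite scalerDl (addrA m); exact: addrAC. 
clearbody phi.
have S := smooth_schwarz (0, 0) ((0, 1) : R * R) ((1, 0) : R * R) sphi.
have F1 : 'D_((1, 0) : R * R) phi = fun z => pairing l (grad f (m + z.1 *: l + z.2 *: h)).
  by apply/funext => z; exact: D1.
have F2 : 'D_((0, 1) : R * R) phi = fun z => pairing h (grad f (m + z.1 *: l + z.2 *: h)).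
  by apply/funext => z; exact: D2.
rewrite F1 F2 in S.
have E1 (e : R) : e *: (1 : R) + 0 = e by rewrite addr0 [e *: 1]mulr1.
rewrite -(has_derivE (pairing_grad_line f m h l)) -(has_derivE (pairing_grad_line f m l h)).
apply: etrans; last apply: (etrans S).
  apply: derive_line => e; rewrite E1; congr (pairing h (grad f _)).
  have -> : (e *: ((1, 0) : R * R) + (0, 0)).1 = e by rewrite /= addr0 [e *: 1]mulr1.
  have -> : (e *: ((1, 0) : R * R) + (0, 0)).2 = 0 by rewrite /= addr0 scaler0.
  by rewrite addr_scale0.
apply/esym; apply: derive_line => e; rewrite E1; congr (pairing l (grad f _)).
have -> : (e *: ((0, 1) : R * R) + (0, 0)).1 = 0 by rewrite /= addr0 scaler0.
have -> : (e *: ((0, 1) : R * R) + (0, 0)).2 = e by rewrite /= addr0 [e *: 1]mulr1.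
by rewrite addr_scale0.
Qed.

(** The Hessian is the derivative in one extra real parameter [e], at [e = 0],
    of the gradient along the smooth family [p s + e *: q s]. *)
Lemma sfam_hess V f (p q : V -> vir_dual R) : fin_dim V ->
  smooth_family setT p -> smooth_family setT q ->
  smooth_family setT (fun s => hess f (p s) (q s)).
Proof.
move=> fV sp sq.
pose G (z : V * R) := grad f (p z.1 + z.2 *: q z.1).
have sG : smooth_family setT G.
  apply: (@grad_fam (V * R)%type f); first exact: fin_dimX.
  apply: (@sfamD R (V * R)%type (fun z => p z.1)).
    exact: (sfam_comp (@clinear_fst R V R) sp).
  apply: (@sfamZ R (V * R)%type snd (fun z => q z.1)).
    exact: (smooth_linear (@clinear_snd R V R)).
  exact: (sfam_comp (@clinear_fst R V R) sq).
have /smooth_familyP[G1 G2] := sG.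
apply/smooth_familyP; split.
  have L : clinear (fun z : V * R => ((z.1, 0), z.2) : (V * R) * R).
    apply: clinear_pair; last exact: clinear_snd.
    by apply: clinear_pair; [exact: clinear_fst|exact: clinear0].
  have := smooth_lin L (smooth_derive (((0, 1), 0) : (V * R) * R) G1).
  congr smooth; apply/funext => -[s x].
  rewrite /= -(has_derivE ((hessP f (p s) (q s)).1 x)).
  apply/esym/derive_line => e.
  have -> : e *: (((0, 1), 0) : (V * R) * R) + ((s, 0), x) = ((s, e *: 1 + 0), x).
    by congr (_, _, _); rewrite /= scaler0 add0r.
  by [].
have L : clinear (fun s : V => (s, 0) : V * R).
  by apply: clinear_pair; [exact: clinear_id|exact: clinear0].
have := smooth_lin L (smooth_derive ((0, 1) : V * R) G2).
congr smooth; apply/funext => s.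
rewrite /= -(has_derivE ((hessP f (p s) (q s)).2)).
apply/esym/derive_line => e.
have -> : e *: ((0, 1) : V * R) + (s, 0) = (s, e *: 1 + 0).
  by congr (_, _); rewrite /= scaler0 add0r.
by [].
Qed.

End Functionals.

(** * The pencil of frozen and Lie-Poisson brackets *)

Section Pencil.
Variable R : realType.
Variables (n : vir_dual R) (lam : R).
Implicit Types (V : normedModType R) (f g k : functional R) (m h : vir_dual R).

(** Evaluating the Lie bracket of the differentials at the affine function
    [n + lam m] of [m] covers all brackets of interest: [lam = 0] freezes the
    bracket at [n], while [n = 0] and [lam = 1] give the Lie-Poisson bracket. *)
Definition pencil_point m : vir_dual R := n + lam *: m.

Definition pencil_bracket : bracket_op R := fun f g m =>
  pairing (pencil_point m) (vbracket (grad f m) (grad g m)).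

(** Up to sign, the Hamiltonian vector field of [g]: the bracket with [g] is
    minus the derivative along it. *)
Definition pencil_field g m : vir_dual R := coad (grad g m) (pencil_point m).

Lemma pairing_vbracketr N (X Y : vir R) :
  pairing N (vbracket X Y) = pairing (coad X N) Y.
Proof. by rewrite (coadP X N Y). Qed.

Lemma pairing_vbracketl N (X Y : vir R) :
  pairing N (vbracket X Y) = - pairing (coad Y N) X.
Proof. by rewrite vbracket_anti pairingNr pairing_vbracketr. Qed.

Lemma pencil_bracketE f g m :
  pencil_bracket f g m = - pairing (pencil_field g m) (grad f m).
Proof. exact: pairing_vbracketl. Qed.

Lemma sfam_point V (p : V -> vir_dual R) : smooth_family setT p ->
  smooth_family setT (fun s => pencil_point (p s)).
Proof.
move=> sp; apply: (@sfamD R V (fun=> n)); first exact: (@sfam_cst R V n).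
exact: (sfamZ (@smooth_cst R V lam) sp).
Qed.

Lemma velocity_point m h :
  is_velocity (fun e : R => pencil_point (m + e *: h)) 0 (lam *: h).
Proof.
have := is_velocity_line (pencil_point m) (lam *: h).
have -> // : (fun e : R => pencil_point (m + e *: h)) =
  fun e => pencil_point m + e *: (lam *: h).
apply/funext => e; rewrite /pencil_point scalerDr addrA; congr (_ + _).
by rewrite !scalerA mulrC.
Qed.

(** The derivative of the bracket of [f] and [g] in the direction [h], by the
    product rule: the evaluation point and both gradients vary. *)
Definition pencil_deriv f g m h : R :=
  lam * pairing h (vbracket (grad f m) (grad g m))
  - pairing (pencil_field g m) (hess f m h) + pairing (pencil_field f m) (hess g m h).

Lemma pencil_line f g m h :
  has_deriv (fun e : R => pencil_bracket f g (m + e *: h)) 0 1 (pencil_deriv f g m h).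
Proof.
have sl := sfam_line m h.
have sf := grad_fam f (@fin_dimR R) sl; have sg := grad_fam g (@fin_dimR R) sl.
have vb := velocity_vbracket sf sg (hessP f m h) (hessP g m h).
have := velocity_pairing (sfam_point sl) (sfam_vbracket sf sg) (velocity_point m h) vb.
apply: has_deriv_ext => //.
rewrite addr_scale0 /pencil_deriv pairingDr pairingZl.
rewrite [RHS]addrA; congr (_ + _ + _).
  exact/esym/pairing_vbracketl.
exact/esym/pairing_vbracketr.
Qed.

(** The gradient of the bracket: by the symmetry of the Hessians the direction
    [h] can be moved out of them in [pencil_deriv]. *)
Definition pencil_grad f g m : vir R :=
  lam *: vbracket (grad f m) (grad g m)
  + (-1) *: hess f m (pencil_field g m) + hess g m (pencil_field f m).

Lemma pencil_gradE f g m h : pairing h (pencil_grad f g m) = pencil_deriv f g m h.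
Proof.
rewrite /pencil_grad !pairingDr !pairingZr mulN1r /pencil_deriv.
by rewrite (hess_sym f m h) (hess_sym g m h).
Qed.

Lemma pencil_gradP f g m h :
  is_derive (0 : R) 1 (fun e : R => pencil_bracket f g (m + e *: h))
    (pairing h (pencil_grad f g m)).
Proof. rewrite pencil_gradE; exact: pencil_line. Qed.

Lemma pencil_smooth f g d (p : 'rV[R]_d -> vir_dual R) : smooth_family setT p ->
  smooth (fun s => pencil_bracket f g (p s)).
Proof.
move=> sp; apply: (sfam_pairing (sfam_point sp)).
exact: (sfam_vbracket (grad_smooth f sp) (grad_smooth g sp)).
Qed.

Lemma sfam_field g d (p : 'rV[R]_d -> vir_dual R) : smooth_family setT p ->
  smooth_family setT (fun s => pencil_field g (p s)).
Proof. by move=> sp; exact: (sfam_coad (grad_smooth g sp) (sfam_point sp)). Qed.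

Lemma pencil_grad_smooth f g d (p : 'rV[R]_d -> vir_dual R) : smooth_family setT p ->
  smooth_family setT (fun s => pencil_grad f g (p s)).
Proof.
move=> sp.
have sb := sfam_vbracket (grad_smooth f sp) (grad_smooth g sp).
have sh1 := sfam_hess f (@fin_dim_rV R d) sp (sfam_field g sp).
have sh2 := sfam_hess g (@fin_dim_rV R d) sp (sfam_field f sp).
have s1 := sfamZ (@smooth_cst R _ (-1)) sh1.
exact: (sfamD (sfamD (sfamZ (@smooth_cst R _ lam) sb) s1) sh2).
Qed.

Definition pencil_functional f g : functional R :=
  Functional (pencil_gradP f g) (@pencil_smooth f g) (@pencil_grad_smooth f g).

(** Pairings with a gradient depend only on the underlying function, which
    makes the Poisson axioms independent of the functionals chosen to
    represent sums, products and brackets. *)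
Lemma grad_unique f m h (F : vir_dual R -> R) (d : R) :
  fval f = F -> has_deriv (fun e : R => F (m + e *: h)) 0 1 d -> pairing h (grad f m) = d.
Proof. by move=> <- Fd; rewrite -(has_derivE (fval_line f m h)) (has_derivE Fd). Qed.

Lemma pencil_bracket_anti f g m : pencil_bracket f g m = - pencil_bracket g f m.
Proof. by rewrite /pencil_bracket vbracket_anti pairingNr. Qed.

Lemma pencil_bracket_iter f g k fg m : fval fg = pencil_bracket f g ->
  pencil_bracket fg k m = - pencil_deriv f g m (pencil_field k m).
Proof.
by move=> Efg; rewrite pencil_bracketE (grad_unique Efg (pencil_line f g m _)).
Qed.

Lemma pairing_jacobi N (X Y Z : vir R) :
  pairing (coad X N) (vbracket Y Z) + pairing (coad Y N) (vbracket Z X)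
  + pairing (coad Z N) (vbracket X Y) = 0.
Proof.
have D (S T U : vir R) : pairing N S + pairing N T + pairing N U = pairing N (S + T + U).
  by rewrite (pairingDr N (S + T)) (pairingDr N S).
have E0 : pairing N (vbracket X (vbracket Y Z) + vbracket Y (vbracket Z X)
                     + vbracket Z (vbracket X Y)) = 0.
  rewrite vbracket_jacobi -(scale0r (0 : vir R)) pairingZr; exact: mul0r.
have EX := pairing_vbracketr N X (vbracket Y Z).
have EY := pairing_vbracketr N Y (vbracket Z X).
have EZ := pairing_vbracketr N Z (vbracket X Y).
have E := D (vbracket X (vbracket Y Z)) (vbracket Y (vbracket Z X))
  (vbracket Z (vbracket X Y)).
exact: (etrans (etrans (congr2 +%R (congr2 +%R (esym EX) (esym EY)) (esym EZ)) E) E0).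
Qed.

(** The arithmetic of the Jacobi identity: [a], [b], [c] are the terms with the
    Lie bracket, the other letters are Hessian terms, which cancel in pairs by
    symmetry. *)
Lemma cyclic_cancel (a b c x y z x' y' z' : R) :
  a + b + c = 0 -> x = x' -> y = y' -> z = z' ->
  - (lam * a - x + y) + - (lam * b - y' + z) + - (lam * c - z' + x') = 0.
Proof.
move=> abc <- <- <-; transitivity (- lam * (a + b + c)); first by ring.
by rewrite abc mulr0.
Qed.

(** Antisymmetry is that of the Lie bracket; linearity and the Leibniz rule
    hold because the bracket with [g] is a derivative along a vector field; in
    the Jacobi identity the Hessians cancel by symmetry, and what remains is
    the Jacobi identity of [vir]. *)
Lemma pencil_poisson : is_poisson pencil_bracket.
Proof.
split.
- by move=> f g; exists (pencil_functional f g).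
- exact: pencil_bracket_anti.
- move=> c f f' k g Ek m; rewrite !pencil_bracketE.
  rewrite (grad_unique Ek (has_derivD (has_derivZ c (fval_line f m _)) (fval_line f' m _))).
  by rewrite opprD mulrN.
- move=> f f' k g Ek m; rewrite !pencil_bracketE.
  rewrite (grad_unique Ek (has_derivM (fval_line f m _) (fval_line f' m _))).
  by rewrite addr_scale0 opprD mulrN mulNr addrC.
- move=> f g h fg gh hf Efg Egh Ehf m.
  rewrite (pencil_bracket_iter h m Efg) (pencil_bracket_iter f m Egh).
  rewrite (pencil_bracket_iter g m Ehf).
  apply: cyclic_cancel.
  - exact: (pairing_jacobi (pencil_point m) (grad h m) (grad f m) (grad g m)).
  - exact: hess_sym.
  - exact: hess_sym.
  - exact: hess_sym.
Qed.

End Pencil.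

Section Compatibility.
Variable R : realType.

Lemma frozen_LP_compatible (m0 : vir_dual R) :
  compatible (frozen_bracket m0) (@LP_bracket R).
Proof.
split.
- have -> : frozen_bracket m0 = pencil_bracket m0 0.
    apply/funext => f; apply/funext => g; apply/funext => m.
    by rewrite /pencil_bracket /pencil_point scale0r addr0.
  exact: pencil_poisson.
- have -> : @LP_bracket R = pencil_bracket 0 1.
    apply/funext => f; apply/funext => g; apply/funext => m.
    by rewrite /pencil_bracket /pencil_point scale1r add0r.
  exact: pencil_poisson.
- move=> lam.
  have -> : (fun f g m => frozen_bracket m0 f g m + lam * LP_bracket f g m) =
    pencil_bracket m0 lam.
    apply/funext => f; apply/funext => g; apply/funext => m.
    by rewrite /pencil_bracket /pencil_point pairingDl pairingZl.
  exact: pencil_poisson.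
Qed.

End Compatibility.

(** * Green's function of the inertia operator *)

Section LambdaAlgebra.
Variables (R : realType) (alpha beta : R).
Local Notation Lam := (Lambda alpha beta : circ R -> circ R).

Lemma LambdaE u x : Lam u x = alpha * u x - beta * Dx (Dx u) x.
Proof. by []. Qed.

Lemma LambdaD u v : Lam (u + v) = Lam u + Lam v.
Proof.
by rewrite /Lambda !DxD !scalerDr opprD addrACA.
Qed.

Lemma LambdaZ (c : R) u : Lam (c *: u) = c *: Lam u.
Proof.
by rewrite /Lambda !DxZ scalerBr !scalerA (mulrC c alpha) (mulrC c beta).
Qed.

Lemma cint_LambdaC u v : cint (Lam u * v) = cint (u * Lam v).
Proof.
apply/eqP; rewrite -subr_eq0 -cintB; apply/eqP.
rewrite (_ : _ - _ = beta *: Dx (u * Dx v - Dx u * v)).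
  by rewrite cintZ cint_Dx mulr0.
rewrite /Lambda (scale_circE alpha u) (scale_circE alpha v) (scale_circE beta (Dx (Dx u))).
rewrite (scale_circE beta (Dx (Dx v))) (scale_circE beta (Dx (u * _ - _))) DxB !DxM; ring.
Qed.

End LambdaAlgebra.

Section GreenKernel.
Variable R : realType.

(** A solution of [G'' = k G] on one period with matching end values; the jump
    of [G'] across the period makes it a fundamental solution on the circle. *)
Record green_kernel (k : R) := GreenKernel {
  gk : R -> R ;
  gk' : R -> R ;
  gk_deriv : forall y : R, has_deriv gk y 1 (gk' y) ;
  gk_deriv' : forall y : R, has_deriv gk' y 1 (k * gk y) ;
  gk_periodic : gk (2 * pi) = gk 0 ;
  gk_jump : gk' (2 * pi) - gk' 0 != 0 }.

Lemma has_deriv_affine (f : R -> R) (df a b y : R) :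
  has_deriv f (a * y + b) 1 df -> has_deriv (fun z => f (a * z + b)) y 1 (a * df).
Proof.
move=> Df; have A : has_deriv (fun z : R => a * z + b) y 1 a.
  apply: (has_deriv_ext _ _ (is_derive_affine y a b)) => // z.
  by rewrite mulrC.
apply: (has_deriv_ext _ _ (@is_derive1_comp _ f (fun z => a * z + b) y _ _ Df A)) => //.
exact: mulrC.
Qed.

(** The kernel is [2 cosh (w (y - pi))] with [w^2 = k]. *)
Lemma gk_exp (k : R) : 0 < k -> green_kernel k.
Proof.
move=> k0; pose w := Num.sqrt k.
have w0 : 0 < w by rewrite sqrtr_gt0.
have wk : w * w = k by rewrite -expr2 sqr_sqrtr// ltW.
pose ep (y : R) := expR (w * y + - (w * pi)).
pose em (y : R) := expR (- w * y + w * pi).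
have Dp y : has_deriv ep y 1 (w * ep y).
  by apply: (has_deriv_affine (f := expR)); exact: is_derive_expR.
have Dm y : has_deriv em y 1 (- w * em y).
  by apply: (has_deriv_affine (f := expR)); exact: is_derive_expR.
apply: (@GreenKernel k (fun y => ep y + em y) (fun y => w * ep y + - w * em y)).
- by move=> y; exact: (has_derivD (Dp y) (Dm y)).
- move=> y; have := has_derivD (has_derivZ w (Dp y)) (has_derivZ (- w) (Dm y)).
  by apply: has_deriv_ext => //; rewrite -wk; ring.
- rewrite /ep /em !mulr0 !add0r addrC; congr (expR _ + expR _); ring.
- have -> : em (2 * pi) = expR (- (w * pi)) by rewrite /em; congr expR; ring.
  have -> : ep (2 * pi) = expR (w * pi) by rewrite /ep; congr expR; ring.
  have -> : em 0 = expR (w * pi) by rewrite /em; congr expR; ring.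
  have -> : ep 0 = expR (- (w * pi)) by rewrite /ep; congr expR; ring.
  have : expR (- (w * pi)) < expR (w * pi).
    by rewrite ltr_expR (@lt_trans _ _ 0)// ?oppr_lt0 mulr_gt0// pi_gt0.
  move: (expR (- (w * pi))) (expR (w * pi)) => a b ab.
  have -> : w * b + - w * a - (w * a + - w * b) = 2 * (w * (b - a)) by ring.
  by rewrite !mulf_neq0 ?pnatr_eq0// gt_eqF// subr_gt0.
Qed.

(** The kernel is [cos (w (y - pi))] with [w^2 = - k]. *)
Lemma gk_cos (k w : R) : w * w = - k -> w * sin (w * pi) != 0 -> green_kernel k.
Proof.
move=> wk ws.
pose c (y : R) := cos (w * y + - (w * pi)).
pose s (y : R) := sin (w * y + - (w * pi)).
have Dc y : has_deriv c y 1 (w * - s y).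
  by apply: (has_deriv_affine (f := cos)); exact: is_derive_cos.
have Ds y : has_deriv s y 1 (w * c y).
  by apply: (has_deriv_affine (f := sin)); exact: is_derive_sin.
apply: (@GreenKernel k c (fun y => - w * s y)).
- by move=> y; apply: (has_deriv_ext _ _ (Dc y)) => //; ring.
- move=> y; apply: (has_deriv_ext _ _ (has_derivZ (- w) (Ds y))) => //.
  by rewrite -[k]opprK -wk; ring.
- rewrite /c mulr0 add0r cosN; congr cos; ring.
- have -> : s (2 * pi) = sin (w * pi) by rewrite /s; congr sin; ring.
  have -> : s 0 = - sin (w * pi) by rewrite /s mulr0 add0r sinN.
  have -> : - w * sin (w * pi) - - w * - sin (w * pi) = - 2 * (w * sin (w * pi)) by ring.
  by rewrite mulf_neq0// oppr_eq0 pnatr_eq0.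
Qed.

(** If [sin (w pi) = 0] then [cos (w x)] has period [2 pi]; this resonance is
    the obstruction to the existence of the kernel. *)
Lemma cos_circ (w : R) : sin (w * pi) = 0 ->
  exists2 v : circ R, Dx (Dx v) = - (w * w) *: v & v 0 = 1.
Proof.
move=> sw; pose c (y : R) := cos (w * y + 0); pose s (y : R) := sin (w * y + 0).
have Dc y : has_deriv c y 1 (- w * s y).
  apply: (@has_deriv_ext _ _ _ _ _ _ _ (w * - s y)) => //; first by ring.
  by apply: (has_deriv_affine (f := cos)); exact: is_derive_cos.
have Ds y : has_deriv s y 1 (w * c y).
  by apply: (has_deriv_affine (f := sin)); exact: is_derive_sin.
have cc : c \in @circ_pred R.
  apply/circ_predP; split.
    apply: (@smooth_ode2 R c (fun y => - w * s y) (- (w * w))) => y; first exact: Dc.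
    by apply: (has_deriv_ext _ _ (has_derivZ (- w) (Ds y))) => //; ring.
  move=> y; rewrite /c.
  have -> : w * (y + 2 * pi) + 0 = (w * y + 0) + (w * pi) *+ 2 by rewrite mulr2n; ring.
  rewrite cosD cos_mulr2n sin_mulr2n sw mulr0 mul0rn mulr0 subr0.
  by rewrite cos2sin2 sw expr0n subr0 mulr2n addrK mulr1.
exists (Circ cc); last by rewrite /= /c mulr0 addr0 cos0.
pose sn := Dx (Circ cc).
have snE y : sn y = - w * s y.
  by have := has_derivE (Dc y); rewrite -derive1E.
apply: Dx_unique => y.
apply: (has_deriv_ext snE _ (has_derivZ (- w) (Ds y))).
by rewrite circZE /=; ring.
Qed.

(** In the oscillating case a vanishing jump would make [cos (w x)] a nonzero
    periodic function in the kernel of [Lambda]. *)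
Lemma green_kernel_ex (alpha beta : R) : alpha != 0 -> beta != 0 ->
  injective (Lambda alpha beta : circ R -> circ R) ->
  inhabited (green_kernel (alpha / beta)).
Proof.
move=> a0 b0 inj; set k := alpha / beta.
have k0 : k != 0 by rewrite mulf_neq0// invr_eq0.
have [kn|kp|/eqP] := ltrgt0P k; last by rewrite (negbTE k0).
  exact/inhabits/gk_exp.
pose w := Num.sqrt (- k).
have w0 : 0 < w by rewrite sqrtr_gt0 oppr_gt0.
have wk : w * w = - k by rewrite -expr2 sqr_sqrtr// oppr_ge0 ltW.
have [sw|sw] := eqVneq (sin (w * pi)) 0; last first.
  by apply/inhabits/(gk_cos wk); rewrite mulf_neq0// gt_eqF.
have [v Dv v0] := cos_circ sw.
have L0 : Lambda alpha beta v = Lambda alpha beta 0.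
  apply: circ_ext => x; rewrite -(scale0r (0 : circ R)) LambdaZ circZE mul0r.
  rewrite LambdaE Dv circZE wk opprK /k; field.
  by rewrite b0.
by have := v0; rewrite (inj _ _ L0) circ0E => /eqP; rewrite eq_sym oner_eq0.
Qed.

End GreenKernel.

Section GreenOperator.
Variables (R : realType) (k : R) (K : green_kernel k).

Lemma gk_smooth : smooth (gk K).
Proof.
by apply: (@smooth_ode2 R (gk K) (gk' K) k) => y; [exact: gk_deriv|exact: gk_deriv'].
Qed.

(** The kernel is integrated against the translates [u (x + y)], so that
    derivatives in [x] fall on [u] and the kernel is only needed on one
    period. *)
Definition green_fun (u : R -> R) (x : R) : R := pint (fun y => gk K y * u (x + y)).

Lemma clinear_sum (V : normedModType R) :
  clinear (fun z : (V * R) * R => (z.1.1, z.1.2 + z.2) : V * R).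
Proof.
apply: clinear_pair.
  exact: (clinear_comp (@clinear_fst R V R) (@clinear_fst R (V * R)%type R)).
apply: (@clinearD R ((V * R) * R)%type R (fun z => z.1.2) snd); last exact: clinear_snd.
exact: (clinear_comp (@clinear_snd R V R) (@clinear_fst R (V * R)%type R)).
Qed.

Lemma green_integrand (V : normedModType R) (p : V -> circ R) : fam p ->
  smooth (fun z : (V * R) * R => gk K z.2 * p z.1.1 (z.1.2 + z.2)).
Proof.
move=> fp; apply: smooth_mul.
  exact: (smooth_lin (@clinear_snd R (V * R)%type R) gk_smooth).
exact: (smooth_lin (@clinear_sum V) fp).
Qed.

Lemma green_fam (V : normedModType R) (p : V -> circ R) : fam p ->
  smooth (fun z : V * R => green_fun (p z.1) z.2).
Proof. by move=> fp; exact: (pint_smooth (green_integrand fp)). Qed.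

Lemma green_circ (u : circ R) : green_fun u \in @circ_pred R.
Proof.
apply/circ_predP; split.
  have := green_fam (@fam_cst R R u).
  move/(smooth_lin (clinear_pair (clinear0 R R) (clinear_id R))).
  by [].
move=> x; rewrite /green_fun; congr pint; apply/funext => y.
by rewrite addrAC circ_periodic.
Qed.

Definition green (u : circ R) : circ R := Circ (green_circ u).

Lemma green_integrand_cont (u : circ R) x : continuous (fun y => gk K y * u (x + y)).
Proof.
have := smooth_cont (green_integrand (@fam_cst R R u)).
by move/(cont_slice (s := (0, x))).
Qed.

Lemma Dx_green u : Dx (green u) = green (Dx u).
Proof.
apply: Dx_unique => x.
have sF : smooth (fun z : R * R => gk K z.2 * u (z.1 + z.2)).
  have L : clinear (fun z : R * R => ((0, z.1), z.2) : (R * R) * R).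
    apply: clinear_pair; last exact: clinear_snd.
    by apply: clinear_pair; [exact: clinear0|exact: clinear_fst].
  exact: (smooth_lin L (green_integrand (@fam_cst R R u))).
apply: (has_deriv_ext _ _ (pint_derive x 1 sF)) => //.
rewrite /= /green_fun; congr pint; apply/funext => y.
have D := has_derivZ (gk K y) (DxP u (x + y)).
rewrite -(has_derivE D); apply/esym/derive_line => e /=.
by rewrite scaler0 add0r addrA.
Qed.

(** Integrate by parts twice in [y]: inside the period the kernel contributes
    [G'' = k G]; by periodicity of [u] the boundary terms reduce to the jump of
    [G'], multiplied by [u x]. *)
Lemma green_solves u : Dx (Dx (green u)) = k *: green u - (gk' K (2 * pi) - gk' K 0) *: u.
Proof.
apply: circ_ext => x; rewrite !Dx_green circDE circNE !circZE /=.
have sh (v : circ R) y : has_deriv (fun z => v (x + z)) y 1 (Dx v (x + y)).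
  apply: (has_deriv_ext _ _ (has_deriv_affine (a := 1) (b := x) (y := y) (DxP v _))).
    by move=> s; rewrite mul1r addrC.
  by rewrite !mul1r addrC.
have D y : has_deriv (fun y => gk K y * Dx u (x + y) + (-1) * (gk' K y * u (x + y))) y 1
    (gk K y * Dx (Dx u) (x + y) - k * (gk K y * u (x + y))).
  have := has_derivD (has_derivM (gk_deriv K y) (sh (Dx u) y))
    (has_derivZ (-1) (has_derivM (gk_deriv' K y) (sh u y))).
  by apply: has_deriv_ext => //; ring.
have c1 := @green_integrand_cont (Dx (Dx u)) x.
have c2 := @green_integrand_cont u x.
have c3 : continuous (fun y => k * (gk K y * u (x + y))).
  by move=> y; apply: cvgM; [exact: cvg_cst|exact: c2].
have := @pint_FTC R _ _ _ D.
rewrite pintB// pintZ// => E.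
rewrite /green_fun -[LHS](subrK (k * pint (fun y => gk K y * u (x + y)))).
rewrite E; last by move=> y; apply: cvgB; [exact: c1|exact: c3].
rewrite !addr0 !circ_periodic gk_periodic; ring.
Qed.

End GreenOperator.

(** * The Euler field and its two Hamiltonian structures *)

Section Inverse.
Variables (R : realType) (alpha beta : R).
Local Notation Lam := (Lambda alpha beta : circ R -> circ R).

(** Bijectivity of [Lambda] only provides an inverse function; Hamiltonians
    built from it are functionals because it preserves smooth families. *)
Definition smooth_inverse (Li : circ R -> circ R) :=
  [/\ cancel Li Lam, cancel Lam Li &
   forall (V : normedModType R) (p : V -> circ R), fam p -> fam (fun s => Li (p s))].

Lemma Lambda_smooth_inverse : alpha != 0 -> injective Lam ->
  exists Li, smooth_inverse Li.
Proof.
move=> a0 inj; have [b0|b0] := eqVneq beta 0.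
  pose Li (u : circ R) := alpha^-1 *: u.
  have LiK : cancel Li Lam.
    move=> u; rewrite LambdaZ /Lambda b0 scale0r subr0 scalerA mulVf//.
    exact: scale1r.
  exists Li; split=> //; first by move=> v; apply: inj; exact: LiK.
  by move=> V p fp; exact: (famZ (@smooth_cst R V alpha^-1) fp).
have [K] := green_kernel_ex a0 b0 inj.
pose c := gk' K (2 * pi) - gk' K 0.
have bc : beta * c != 0 by rewrite mulf_neq0// gk_jump.
pose Li (u : circ R) := (beta * c)^-1 *: green K u.
have LiK : cancel Li Lam.
  move=> u; have E : Lam (green K u) = (beta * c) *: u.
    rewrite /Lambda green_solves -/c (scalerBr beta) (scalerA beta (alpha / beta)).
    rewrite (scalerA beta c) (mulrC beta (alpha / beta)) divfK// opprB addrC.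
    exact: subrK.
  by rewrite /Li LambdaZ E scalerA mulVf// scale1r.
exists Li; split=> //; first by move=> v; apply: inj; exact: LiK.
move=> V p fp; apply: (famZ (@smooth_cst R V (beta * c)^-1)).
exact: green_fam.
Qed.

End Inverse.

Section EulerField.
Variables (R : realType) (alpha beta : R) (Li : circ R -> circ R).
Hypothesis LiP : smooth_inverse alpha beta Li.
Local Notation Lam := (Lambda alpha beta : circ R -> circ R).
Implicit Types (u v w : circ R) (m h : vir_dual R) (X Y : vir R).

Let LiK : cancel Li Lam. Proof. by have [] := LiP. Qed.
Let LamK : cancel Lam Li. Proof. by have [] := LiP. Qed.
Let Lifam (V : normedModType R) (p : V -> circ R) : fam p -> fam (fun s => Li (p s)).
Proof. by have [_ _ H] := LiP; exact: H. Qed.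

Lemma LiD u v : Li (u + v) = Li u + Li v.
Proof. by apply: (can_inj LamK); rewrite LambdaD !LiK. Qed.

Lemma LiZ (c : R) u : Li (c *: u) = c *: Li u.
Proof. by apply: (can_inj LamK); rewrite LambdaZ !LiK. Qed.

(** The inverse of a symmetric operator is symmetric. *)
Lemma cint_LiC u w : cint (Li u * w) = cint (u * Li w).
Proof. by rewrite -[in LHS](LiK w) -cint_LambdaC LiK. Qed.

Definition inertia_inv m : vir R := (Li m.1, m.2).

Definition euler_field m : vir_dual R := (-1) *: coad (inertia_inv m) m.

Lemma euler_fieldP : is_euler_field alpha beta euler_field.
Proof.
move=> X Y; rewrite /euler_field scaleN1r opprK (coadP _ _ Y).
by rewrite /inertia_inv /inertia /= LamK; case: X.
Qed.

Lemma inertia_pairing X Y :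
  pairing (inertia alpha beta X) Y = H1_metric alpha beta X Y.
Proof.
case: X Y => [v b] [w c]; congr (_ + _); rewrite /=.
apply/eqP; rewrite -subr_eq0 -cintB; apply/eqP.
rewrite (_ : _ - _ = (- beta) *: Dx (Dx v * w)).
  by rewrite cintZ cint_Dx mulr0.
rewrite scaleNr /Lambda (scale_circE alpha v) (scale_circE alpha (v * w)).
rewrite (scale_circE beta (Dx (Dx v))) (scale_circE beta (Dx v * Dx w)).
rewrite (scale_circE beta (Dx (Dx v * w))) !DxM; ring.
Qed.

Lemma is_vel_Li u w : is_vel (fun e : R => Li (u + e *: w)) 0 (Li w).
Proof.
move=> x; apply: (has_deriv_ext _ _ (is_derive_affine 0 (Li w x) (Li u x))) => // s.
by rewrite LiD LiZ circDE circZE addrC.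
Qed.

Lemma fam_Li_line u w : fam (fun e : R => Li (u + e *: w)).
Proof.
by apply: Lifam; have /smooth_familyP[] := sfam_line ((u, 0) : vir_dual R) (w, 0).
Qed.

Lemma sfam_inertia_inv (V : normedModType R) (p : V -> vir_dual R) :
  smooth_family setT p -> smooth_family setT (fun s => inertia_inv (p s)).
Proof.
by move=> /smooth_familyP[p1 p2]; apply/smooth_familyP; split => //; exact: Lifam p1.
Qed.

Lemma pairing_inertia_invC m h : pairing m (inertia_inv h) = pairing h (inertia_inv m).
Proof. by rewrite /pairing /= -cint_LiC mulrC (mulrC m.2). Qed.

Section LiePoisson.

(** Minus the kinetic energy: the Lie-Poisson Hamiltonian equation is
    [m' = ad^*_{df} m], while the Euler equation is [m' = - ad^*_{A^-1 m} m]. *)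
Definition energy m : R := - 2^-1 * pairing m (inertia_inv m).
Definition energy_grad m : vir R := (-1) *: inertia_inv m.

Lemma energy_gradP m h :
  is_derive (0 : R) 1 (fun e : R => energy (m + e *: h)) (pairing h (energy_grad m)).
Proof.
have sl := sfam_line m h.
have vI : is_velocity (fun e : R => inertia_inv (m + e *: h)) 0 (inertia_inv h).
  by split; [exact: (is_vel_Li m.1 h.1)|exact: (is_velocity_line m h).2].
have D := velocity_pairing sl (sfam_inertia_inv sl) (is_velocity_line m h) vI.
apply: (has_deriv_ext _ _ (has_derivZ (- 2^-1) D)) => //.
rewrite addr_scale0 pairingZr (pairing_inertia_invC m h).
by field.
Qed.

Lemma energy_smooth d (p : 'rV[R]_d -> vir_dual R) : smooth_family setT p ->
  smooth (fun s => energy (p s)).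
Proof.
move=> sp; apply: (smooth_mul (@smooth_cst R _ (- 2^-1))).
exact: (sfam_pairing sp (sfam_inertia_inv sp)).
Qed.

Lemma energy_grad_smooth d (p : 'rV[R]_d -> vir_dual R) : smooth_family setT p ->
  smooth_family setT (fun s => energy_grad (p s)).
Proof. by move=> sp; exact: (sfamZ (@smooth_cst R _ (-1)) (sfam_inertia_inv sp)). Qed.

Lemma euler_LP_hamiltonian : LP_hamiltonian euler_field.
Proof.
exists (Functional energy_gradP energy_smooth energy_grad_smooth) => m Y /=.
rewrite /euler_field /energy_grad vbracketZl pairingZl pairingZr.
by congr (_ * _); exact: (coadP (inertia_inv m) m Y).
Qed.

End LiePoisson.

Section Frozen.

Let A : circ R := (alpha / 2) *: (1 : circ R).
Let B : circ R := (beta / 2) *: (1 : circ R).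

(** Minus the integral of [alpha/2 v^3 + beta/2 v v_x^2 + c/2 v_x^2], where
    [v] is the velocity and [c] the central component. *)
Definition cubic_energy m : R :=
  let v := Li m.1 in
  (-1) * (cint (v * v * v * A + v * (Dx v * Dx v) * B)
     + m.2 * (2^-1 * cint (Dx v * Dx v))).

(** The variational derivative of [cubic_energy] with respect to [v]. *)
Definition cubic_density v (c : R) : circ R :=
  - (v * v * A + v * v * A + v * v * A - (v * Dx (Dx v) * B + v * Dx (Dx v) * B)
     - Dx v * Dx v * B - c *: Dx (Dx v)).

Definition cubic_grad m : vir R :=
  (Li (cubic_density (Li m.1) m.2), - 2^-1 * cint (Dx (Li m.1) * Dx (Li m.1))).

(** The first variation in the direction [w], integrated by parts: the
    difference of the integrands is the derivative of
    [beta v v_x w + c v_x w]. *)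
Lemma cubic_variation v w (c : R) :
  cint (((w * v + v * w) * v + v * v * w) * A
        + (w * (Dx v * Dx v) + v * (Dx w * Dx v + Dx v * Dx w)) * B)
  + c * (2^-1 * cint (Dx w * Dx v + Dx v * Dx w)) = - cint (w * cubic_density v c).
Proof.
have -> : 2^-1 * cint (Dx w * Dx v + Dx v * Dx w) = cint (Dx w * Dx v).
  by rewrite (mulrC (Dx v)) cintD; field.
rewrite -cintZ -cintD; apply/eqP; rewrite -addr_eq0 -cintD; apply/eqP.
rewrite (_ : _ + _ = Dx (v * Dx v * w * B + v * Dx v * w * B
    + (c *: (1 : circ R)) * Dx v * w)).
  exact: cint_Dx.
rewrite /cubic_density (scale_circE c (Dx (Dx v))) (scale_circE c (_ * _)).
by rewrite /B !(DxD, DxM) !Dx_cst; ring.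
Qed.

Lemma cubic_gradP m h :
  is_derive (0 : R) 1 (fun e : R => cubic_energy (m + e *: h)) (pairing h (cubic_grad m)).
Proof.
have f := fam_Li_line m.1 h.1; have vf := is_vel_Li m.1 h.1.
have fx := fam_Dx f; have vx := is_vel_Dx f vf.
have fA := @fam_cst R R A; have vA := is_vel_cst A 0.
have fB := @fam_cst R R B; have vB := is_vel_cst B 0.
have f1 := famD (famM (famM (famM f f) f) fA) (famM (famM f (famM fx fx)) fB).
have v1 := is_velD (is_velM (is_velM (is_velM vf vf) vf) vA)
  (is_velM (is_velM vf (is_velM vx vx)) vB).
have D := has_derivD (is_vel_cint f1 v1)
  (has_derivM (is_velocity_line m h).2
     (has_derivZ 2^-1 (is_vel_cint (famM fx fx) (is_velM vx vx)))).
apply: (has_deriv_ext _ _ (has_derivZ (-1) D)) => //.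
have -> : m.1 + (0 : R) *: h.1 = m.1 by rewrite scale0r addr0.
have -> : (m + (0 : R) *: h).2 = m.2 by rewrite addr_scale0.
rewrite /pairing /cubic_grad /= -(cint_LiC h.1) !mulr0 !addr0.
(* [T] and [S] are the terms of the first variation, [C] its value. *)
have arith (T S C q c : R) :
    T + S = - C -> C + c * (- 2^-1 * q) = -1 * (T + (c * (2^-1 * q) + S)).
  by move=> E; rewrite -[C]opprK -E; ring.
exact: (arith _ _ _ _ _ (cubic_variation (Li m.1) (Li h.1) m.2)).
Qed.

Lemma cubic_smooth d (p : 'rV[R]_d -> vir_dual R) : smooth_family setT p ->
  smooth (fun s => cubic_energy (p s)).
Proof.
move=> /smooth_familyP[p1 p2]; have f := Lifam p1; have fx := fam_Dx f.
have fA := @fam_cst R 'rV[R]_d A; have fB := @fam_cst R 'rV[R]_d B.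
have f1 := famD (famM (famM (famM f f) f) fA) (famM (famM f (famM fx fx)) fB).
apply: (smooth_mul (@smooth_cst R _ (-1))); apply: (smooth_add (fam_cint f1)).
apply: (smooth_mul p2); apply: (smooth_mul (@smooth_cst R _ 2^-1)).
exact: (fam_cint (famM fx fx)).
Qed.

Lemma cubic_grad_smooth d (p : 'rV[R]_d -> vir_dual R) : smooth_family setT p ->
  smooth_family setT (fun s => cubic_grad (p s)).
Proof.
move=> /smooth_familyP[p1 p2]; have f := Lifam p1; have fx := fam_Dx f.
have fxx := fam_Dx fx; apply/smooth_familyP; split; last first.
  apply: (smooth_mul (@smooth_cst R _ (- 2^-1))).
  exact: (fam_cint (famM fx fx)).
have fA := @fam_cst R 'rV[R]_d A; have fB := @fam_cst R 'rV[R]_d B.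
have fvA := famM (famM f f) fA; have fvB := famM (famM f fxx) fB.
apply: Lifam; apply: famN.
apply: (famB _ (famZ p2 fxx)); apply: (famB _ (famM (famM fx fx) fB)).
exact: (famB (famD (famD fvA fvA) fvA) (famD fvB fvB)).
Qed.

Lemma scale_alphaE v : alpha *: v = (A + A) * v.
Proof.
by apply: circ_ext => x; rewrite circZE circME circDE circZE circ1E; field.
Qed.

Lemma scale_betaE v : beta *: v = (B + B) * v.
Proof.
by apply: circ_ext => x; rewrite circZE circME circDE circZE circ1E; field.
Qed.

(** At the freezing point [(alpha/2, beta)] the coadjoint action of [(w, c)] is
    [alpha w_x - beta w_xxx], that is the derivative of [Lambda w].  Since the
    gradient of [cubic_energy] in [u = Lambda v] has first component
    [Lambda^-1] of [cubic_density], the operator cancels, and the derivative of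
    [cubic_density] is the right-hand side of the Euler equation. *)
Lemma euler_field_frozen m :
  euler_field m = coad (cubic_grad m) ((alpha / 2) *: (1 : circ R), beta).
Proof.
rewrite /euler_field /cubic_grad.
case: m => [u c]; rewrite /inertia_inv /coad /=; set v := Li u.
have -> : u = Lam v by rewrite /v LiK.
set P := cubic_density v c; set w := Li P.
have PE : P = Lam w by rewrite /w LiK.
apply: vir_ext; last exact: mulr0.
transitivity (Dx P); last first.
  rewrite PE /Lambda DxB /=.
  rewrite (scale_alphaE w) (scale_betaE (Dx (Dx w))) (scale_betaE (Dx (Dx (Dx w)))) !DxM !DxD -/A.
  rewrite (Dx_cst (alpha / 2)) (Dx_cst (beta / 2)); ring.
change ((-1) *: (Dx (Lam v) * v + (Lam v + Lam v) * Dx v - c *: Dx (Dx (Dx v))) = Dx P).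
rewrite scaleN1r /P /cubic_density /Lambda (scale_alphaE v) (scale_betaE (Dx (Dx v))).
rewrite (scale_circE c (Dx (Dx v))) (scale_circE c (Dx (Dx (Dx v)))).
rewrite !(DxD, DxN, DxM) (Dx_cst (alpha / 2)) (Dx_cst (beta / 2)) (Dx_cst c); ring.
Qed.

Lemma euler_frozen_hamiltonian :
  frozen_hamiltonian ((alpha / 2) *: (1 : circ R), beta) euler_field.
Proof.
exists (Functional cubic_gradP cubic_smooth cubic_grad_smooth) => m.
rewrite euler_field_frozen; exact: coadP.
Qed.

End Frozen.

Section EulerEquation.
Variables (J : set R) (v : R -> circ R) (b : R -> R).
Hypothesis vb : smooth_family J (fun t => (v t, b t)).

Lemma Dx_joint_fun (p : R -> circ R) :
  (fun z : R * R => Dx (p z.1) z.2) = 'D_((0, 1) : R * R) (fun z => p z.1 z.2).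
Proof. by apply/funext => -[s x]; exact: Dx_joint. Qed.

Lemma derivable_slice (F : R * R -> R) (t x : R) :
  derivable F (t, x) ((1, 0) : R * R) -> derivable (fun s => F (s, x)) t 1.
Proof. by apply: derivable_line => e; congr F; congr pair; rewrite /= scaler0 add0r. Qed.

(** Smoothness is only known for times in [J], but [Dx (v s) x] is a directional
    derivative of the joint function for every [s], because [Dx] is defined
    fibrewise; hence [v_xx] is an iterated directional derivative of a function
    smooth on the product of [J] and the line. *)
Lemma has_deriv_time t x : J t ->
  has_deriv (fun s => v s x) t 1 (derive1 (fun s => v s x) t) /\
  has_deriv (fun s => Dx (Dx (v s)) x) t 1 (derive1 (fun s => Dx (Dx (v s)) x) t).
Proof.
move=> Jt; have [sv _] := vb; rewrite !derive1E.
have Jtx : (J `*` [set: R]) (t, x) by [].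
split; split=> //.
  exact: (derivable_slice (((sv 1%N).2 (1, 0)).1 (t, x) Jtx)).
have := (((((sv 3%N).2 (0, 1)).2).2 (0, 1)).2.2 (1, 0)).1 (t, x) Jtx.
rewrite -[X in derive X](Dx_joint_fun v).
rewrite -(Dx_joint_fun (fun s => Dx (v s))) => H.
exact: (derivable_slice H).
Qed.

Lemma has_deriv_b t : J t -> has_deriv b t 1 (derive1 b t).
Proof.
by move=> Jt; have [_ sb] := vb; rewrite derive1E; split=> //; exact: ((sb 1%N).2 1).1.
Qed.

Lemma has_deriv_inertia t x : J t ->
  has_deriv (fun s => Lam (v s) x) t 1
    (alpha * derive1 (fun s => v s x) t - beta * derive1 (fun s => Dx (Dx (v s)) x) t).
Proof.
move=> /(has_deriv_time x)[D1 D2].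
apply: (has_deriv_ext _ _ (has_derivD (has_derivZ alpha D1) (has_derivZ (- beta) D2))).
  by move=> s; rewrite LambdaE mulNr.
by rewrite mulNr.
Qed.

Lemma euler_field_inertiaE t x :
  (euler_field (inertia alpha beta (v t, b t))).1 x =
  - (alpha * (3 * v t x * Dx (v t) x)
     - beta * (2 * Dx (v t) x * Dx (Dx (v t)) x + v t x * Dx (Dx (Dx (v t))) x)
     - b t * Dx (Dx (Dx (v t))) x).
Proof.
rewrite /euler_field /inertia_inv /inertia /= LamK.
change ((-1) * ((Dx (Lam (v t)) x * v t x + (Lam (v t) x + Lam (v t) x) * Dx (v t) x
  - b t * Dx (Dx (Dx (v t))) x)) = 
  - (alpha * (3 * v t x * Dx (v t) x)
     - beta * (2 * Dx (v t) x * Dx (Dx (v t)) x + v t x * Dx (Dx (Dx (v t))) x)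
     - b t * Dx (Dx (Dx (v t))) x)).
have -> : Dx (Lam (v t)) = Lam (Dx (v t)) by rewrite /Lambda DxB !DxZ.
rewrite (LambdaE alpha beta (v t) x) (LambdaE alpha beta (Dx (v t)) x).
move: (v t x) (Dx (v t) x) (Dx (Dx (v t)) x) (Dx (Dx (Dx (v t))) x) => v0 v1 v2 v3.
ring.
Qed.

(** The Euler equation solved for the velocity of [Lambda v]. *)
Lemma euler_equation_split (vt v0 vx vxx vxxx vxxt c : R) :
  alpha * (vt + 3 * v0 * vx) - beta * (vxxt + 2 * vx * vxx + v0 * vxxx) - c * vxxx = 0 <->
  alpha * vt - beta * vxxt =
    - (alpha * (3 * v0 * vx) - beta * (2 * vx * vxx + v0 * vxxx) - c * vxxx).
Proof.
set r := alpha * (3 * v0 * vx) - _ - _; split=> e.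
  by apply: subr0_eq; rewrite -[RHS]e /r; ring.
have {}e : alpha * vt - beta * vxxt + r = 0 by rewrite e addNr.
by rewrite -[RHS]e /r; ring.
Qed.

Lemma euler_equation_velocity t : J t ->
  ((forall x, euler_equation_at alpha beta v b t x) /\ derive1 b t = 0) <->
  is_velocity (fun s => inertia alpha beta (v s, b s)) t
    (euler_field (inertia alpha beta (v t, b t))).
Proof.
move=> Jt.
have E2 : (euler_field (inertia alpha beta (v t, b t))).2 = 0 by exact: mulr0.
split=> [[eul b0]|[vel velb]]; split.
- move=> x; have /euler_equation_split e := eul x.
  rewrite euler_field_inertiaE -e; exact: has_deriv_inertia.
- by apply: (has_deriv_ext _ _ (has_deriv_b Jt)) => //; rewrite E2 b0.
- move=> x; apply/euler_equation_split.
  rewrite -(has_derivE (has_deriv_inertia x Jt)) -euler_field_inertiaE.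
  exact: (has_derivE (vel x)).
- by have := has_derivE velb; rewrite (has_derivE (has_deriv_b Jt)) E2.
Qed.

End EulerEquation.

End EulerField.

Theorem theorem5p5 (R : realType) (alpha beta : R) :
  alpha != 0 ->
  bijective (Lambda alpha beta : circ R -> circ R) ->
  (forall X Y : vir R,
     pairing (inertia alpha beta X) Y = H1_metric alpha beta X Y) /\
  exists E : vir_dual R -> vir_dual R,
    [/\ is_euler_field alpha beta E,
        forall (J : set R) (v : R -> circ R) (b : R -> R),
          open J -> smooth_family J (fun t => (v t, b t)) ->
          (forall t, J t ->
             (forall x, euler_equation_at alpha beta v b t x) /\
             derive1 b t = 0) <->
          (forall t, J t ->
             is_velocity (fun s => inertia alpha beta (v s, b s)) t
               (E (inertia alpha beta (v t, b t))))
      & bihamiltonian (((alpha / 2) *: (1 : circ R), beta) : vir_dual R) E].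
Proof.
move=> a0 bij; split; first by move=> X Y; exact: inertia_pairing.
have [Li LiP] := Lambda_smooth_inverse a0 (bij_inj bij).
exists (euler_field Li); split.
- exact: (euler_fieldP LiP).
- move=> J v b _ vb; split=> H t Jt.
    exact: (proj1 (euler_equation_velocity LiP vb Jt) (H t Jt)).
  exact: (proj2 (euler_equation_velocity LiP vb Jt) (H t Jt)).
- split; [exact: frozen_LP_compatible|exact: (euler_LP_hamiltonian LiP)|].
  exact: (euler_frozen_hamiltonian LiP).
Qed.
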